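(* As $T\to0$, $\lambda_T^{-1}\big(1/(2\pi)\big)\sim\sqrt{2T\log(1/T)}$, i.e. the ratio of the two sides converges to $1$ as $T\downarrow0$.
   Context: Let $\gamma_T$ be the centered Gaussian measure on $\mathbb{R}$ with variance $T>0$. For $r>0$ let $H_{r,T}$ be the closure, with respect to the norm $\|f\|_{L^2(\gamma_T)}+\|f'\|_{L^2(\gamma_T)}$, of the smooth functions with compact support contained in $(-r,r)$. Let $\lambda_T(r)$ be the leading Dirichlet eigenvalue on $(-r,r)$ of $-L_T$, where $L_Tf(x)=f''(x)-T^{-1}xf'(x)$, i.e. the smallest $\lambda\ge0$ for which there is a (nonzero) $f\in H_{r,T}$ with $-L_Tf=\lambda f$; equivalently $$\lambda_T(r)=\inf\{\|f'\|^2_{L^2(\gamma_T)}:f\in H_{r,T},\ \|f\|_{L^2(\gamma_T)}=1\}.$$ The function $r\mapsto\lambda_T(r)$ on $(0,\infty)$ is convex and strictly decreasing, and $\lambda_T^{-1}$ denotes its inverse. *)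

(* Defs.v *)
From HB Require Import structures.
From mathcomp Require Import all_boot all_order all_algebra.
From mathcomp Require Import all_classical all_reals all_analysis.

Set Implicit Arguments.
Unset Strict Implicit.
Unset Printing Implicit Defensive.

Import Order.TTheory GRing.Theory Num.Theory.
Import numFieldNormedType.Exports.

Local Open Scope classical_set_scope.
Local Open Scope ring_scope.

(* The second parameter of [normal_prob] is the standard deviation. *)
Definition gaussian {R : realType} (T : R) : probability _ R :=
  normal_prob 0 (Num.sqrt T).

Definition l2norm {R : realType} (T : R) (f : R -> R) : \bar R :=
  ('N[gaussian T]_2%:E[EFin \o f])%E.

Definition smooth {R : realType} (phi : R -> R) : Prop :=
  forall (n : nat) (x : R), derivable (derive1n n phi) x 1.

Definition test_function {R : realType} (r : R) (phi : R -> R) : Prop :=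
  let K := closure [set x | phi x != 0] in
  [/\ smooth phi, compact K & K `<=` `]- r, r[].

(* Closure of the test functions for the norm |f|_{L^2} + |f'|_{L^2}.
   The function g plays the role of f': as the L^2-limit of derivatives of test
   functions converging to f in L^2, it is the weak derivative of f, hence
   determined by f up to a null set. *)
Definition dirichlet_space {R : realType} (T r : R) : set (R -> R) :=
  [set f : R -> R | exists g : R -> R,
    [/\ measurable_fun [set: R] f, measurable_fun [set: R] g &
      forall e : R, 0 < e -> exists2 phi, test_function r phi &
        (l2norm T (f \- phi)%R + l2norm T (g \- derive1 phi)%R < e%:E)%E]].

Definition ou_generator {R : realType} (T : R) (f : R -> R) (x : R) : R :=
  derive1n 2 f x - T^-1 * x * derive1 f x.

(* Elements of the Dirichlet space are functions up to null sets. The equation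
   is the classical one, for a representative f that is twice differentiable
   on (-r, r). *)
Definition dirichlet_eigenvalue {R : realType} (T r : R) : set R :=
  [set l | 0 <= l /\ exists f : R -> R,
    [/\ dirichlet_space T r f,
        ~ {ae gaussian T, forall x, f x = 0},
        forall x, x \in `]- r, r[ ->
          derivable f x 1 /\ derivable (derive1 f) x 1 &
        forall x, x \in `]- r, r[ -> - ou_generator T f x = l * f x]].

(* The smallest eigenvalue; the default value 0 would only be used if there
   were no smallest eigenvalue. *)
Definition leading_eigenvalue {R : realType} (T r : R) : R :=
  xget 0 (dirichlet_eigenvalue T r `&` lbound (dirichlet_eigenvalue T r)).

(* Inverse of r |-> leading_eigenvalue T r on (0, +oo), with default value 0
   outside the range. *)
Definition leading_eigenvalue_inv {R : realType} (T : R) : R -> R :=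
  'pinv_(fun=> 0) `]0, +oo[%classic (leading_eigenvalue T).

(* Main.v *)
(** The even solution with value 1 at 0 of [f'' - (x / T) f' + l f = 0] is
    [h_l x = K (x^2 / (2 T))], with [K] the Kummer function of parameters
    [- l T / 2] and [1 / 2]. When [0 < l T <= 1], all the coefficients of [K]
    but the first one are negative, so [h_l] decreases in [|x|] and has a
    single positive zero [r].
    The number [l] is then the leading eigenvalue on [(- r, r)]. On the one
    hand the positive part of [h_l] is an eigenfunction: the functions
    [psi_d (h_l - d)], with [psi_d v = v exp (- d / v)] for [v > 0], are test
    functions converging to it. On the other hand, if [h_l > 0] on [[- r, r]],
    an eigenfunction [f] with eigenvalue [m <= l] would make
    [exp (- x^2 / (2 T)) h_l^2 ((f / h_l)^2)'] nondecreasing, so that [|f|]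
    would be bounded away from 0 near [r] or near [- r], whereas [f] is a limit
    of functions vanishing there with bounded Dirichlet energy. Since [h_l r] is
    continuous in [l] and two functions [h_l] have no common zero, the inverse
    of the leading eigenvalue at [l] is the zero of [h_l].
    Finally, with [a = l T / 2] and [z = r^2 / (2 T)], comparing the
    coefficients of [K] with those of the exponential gives
    [1 + 2 a <= 2 a exp z] and [a (exp z - 1 - z) <= z], and the asymptotics
    follow from [z >= ln (1 / T)] and
    [(sqrt z - 1)^2 <= ln (1 / T) + constant]. *)

Require Import Defs.
From HB Require Import structures.
From mathcomp Require Import all_boot all_order all_algebra.
From mathcomp Require Import all_classical all_reals all_analysis.
From mathcomp Require Import measurable_realfun ring lra.

Set Implicit Arguments.
Unset Strict Implicit.
Unset Printing Implicit Defensive.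

Import Order.TTheory GRing.Theory Num.Theory.
Import numFieldNormedType.Exports.

Local Open Scope classical_set_scope.
Local Open Scope ring_scope.

(** * Power series and the Kummer function *)

Section power_series.
Variable R : realType.
Implicit Types (c d : R^nat) (x : R).

Definition fact_bounded c := forall n, `|c n| <= n`!%:R^-1.

Definition psum c x : R := limn (pseries c x).

Lemma fact_bounded_is_cvg c x : fact_bounded c -> cvgn (pseries c x).
Proof.
move=> cb; apply: normed_cvg.
apply: (@series_le_cvg _ _ (exp_coeff `|x|)) => //=.
- by move=> n; exact: exp_coeff_ge0.
- by move=> n; rewrite exp_coeffE normrM normrX ler_wpM2r// exprn_ge0.
- exact: is_cvg_series_exp_coeff.
Qed.

Lemma fact_bounded_diffs c : fact_bounded c -> fact_bounded (pseries_diffs c).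
Proof.
move=> cb n; rewrite /pseries_diffs normrM normr_nat.
rewrite (le_trans (ler_wpM2l _ (cb n.+1)))// factS natrM invfM mulrA divff ?mul1r//.
Qed.

Lemma psum_is_derive c x : fact_bounded c ->
  is_derive x 1 (psum c) (psum (pseries_diffs c) x).
Proof.
move=> cb; apply: (@pseries_snd_diffs _ _ (`|x| + 1)).
- exact: fact_bounded_is_cvg.
- exact/fact_bounded_is_cvg/fact_bounded_diffs.
- exact/fact_bounded_is_cvg/fact_bounded_diffs/fact_bounded_diffs.
- by rewrite [ltRHS]ger0_norm// ltrDl.
Qed.

Lemma psumB c d x : cvgn (pseries c x) -> cvgn (pseries d x) ->
  cvgn (pseries (fun n => c n - d n) x) /\
  psum (fun n => c n - d n) x = psum c x - psum d x.
Proof.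
move=> cc cd.
have E : pseries (fun n => c n - d n) x = pseries c x - pseries d x.
  rewrite /pseries -seriesN -seriesD; congr series.
  by apply/funext => n /=; rewrite -[RHS]/(_ - _) mulrBl.
by rewrite /psum E; split; [exact: is_cvgB|rewrite limB].
Qed.

Lemma psum0 c : psum c 0 = c 0%N.
Proof.
apply: lim_near_cst => //; near=> m.
have m0 : (0 < m)%N by near: m.
rewrite /pseries/= /series/= -(prednK m0) big_nat_recl//= expr0 mulr1.
by rewrite big1 ?addr0// => i _; rewrite exprS mul0r mulr0.
Unshelve. all: by end_near. Qed.

End power_series.

Section kummer.
Variable R : realType.
Implicit Types (a b x z : R) (n : nat).

(* Coefficients of the Kummer function 1F1(-a; 1/2; z). *)
Fixpoint kummer_coef a n : R :=
  if n is m.+1 then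
    kummer_coef a m * ((m%:R - a) / (m%:R + 1 / 2)) / m.+1%:R
  else 1.

Definition kummer a : R -> R := psum (kummer_coef a).
Definition dkummer a : R -> R := psum (pseries_diffs (kummer_coef a)).
Definition ddkummer a : R -> R :=
  psum (pseries_diffs (pseries_diffs (kummer_coef a))).

Lemma kummer_ratio_le1 a n : 0 <= a <= 1 / 2 ->
  `|(n%:R - a) / (n%:R + 1 / 2)| <= 1.
Proof.
move=> /andP[a0 a1]; have n0 := ler0n R n.
have d0 : 0 < n%:R + 1 / 2 :> R by lra.
rewrite normrM [X in _ * X]gtr0_norm ?invr_gt0// ler_pdivrMr// mul1r ler_norml.
by apply/andP; split; lra.
Qed.

Lemma kummer_coef_bounded a : 0 <= a <= 1 / 2 -> fact_bounded (kummer_coef a).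
Proof.
move=> a01; elim=> [|n ih] /=; first by rewrite normr1 fact0 invr1.
rewrite normrM [X in _ * X]ger0_norm ?invr_ge0// factS natrM invfM [leRHS]mulrC.
rewrite ler_wpM2r ?invr_ge0// normrM.
by rewrite -[leRHS]mulr1 ler_pM// kummer_ratio_le1.
Qed.

Lemma kummer_is_cvg a z : 0 <= a <= 1 / 2 -> cvgn (pseries (kummer_coef a) z).
Proof. by move=> a01; apply/fact_bounded_is_cvg/kummer_coef_bounded. Qed.

Lemma is_derive_kummer a z : 0 <= a <= 1 / 2 ->
  is_derive z 1 (kummer a) (dkummer a z).
Proof. by move=> a01; apply/psum_is_derive/kummer_coef_bounded. Qed.

Lemma is_derive_dkummer a z : 0 <= a <= 1 / 2 ->
  is_derive z 1 (dkummer a) (ddkummer a z).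
Proof.
by move=> a01; apply/psum_is_derive/fact_bounded_diffs/kummer_coef_bounded.
Qed.

Lemma kummer_at0 a : kummer a 0 = 1.
Proof. by rewrite /kummer psum0. Qed.

Lemma cvg_mul_psum_diffs (c : R^nat) z : fact_bounded c ->
  series (fun n => n%:R * c n * z ^+ n) @ \oo --> z * psum (pseries_diffs c) z.
Proof.
move=> cb.
have := @pseries_diffs_equiv R c z (fact_bounded_is_cvg (fact_bounded_diffs cb)).
move=> /(@cvgMl_tmp _ _ _ _ _ z); apply: cvg_trans; apply: near_eq_cvg; near=> n.
rewrite /series/= mulr_sumr; apply: eq_bigr => -[|i] _; first by rewrite !mul0r mulr0.
by rewrite /= exprS; ring.
Unshelve. all: by end_near. Qed.

Lemma kummer_ode a z : 0 <= a <= 1 / 2 ->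
  z * ddkummer a z + (1 / 2 - z) * dkummer a z + a * kummer a z = 0.
Proof.
move=> a01; have cb := kummer_coef_bounded a01; have db := fact_bounded_diffs cb.
have c0 := @fact_bounded_is_cvg _ _ z cb.
have c1 := @fact_bounded_is_cvg _ _ z db.
have e1 := @cvg_mul_psum_diffs _ z cb.
have e2 := @cvg_mul_psum_diffs _ z db.
set c := kummer_coef a in cb db c0 c1 e1 e2.
have H := cvgD (cvgB (cvgD e2 (cvgMr_tmp (b := 1 / 2) c1)) e1) (cvgMr_tmp (b := a) c0).
have H0 : (0 : R^nat) @ \oo --> z * psum (pseries_diffs (pseries_diffs c)) z +
    limn (pseries (pseries_diffs c) z) * (1 / 2) -
    z * psum (pseries_diffs c) z + limn (pseries c z) * a.
  apply: cvg_trans (H _ _ _ _ _); apply: near_eq_cvg; near=> n.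
  rewrite /pseries/= !fctE /series/= !mulr_suml -sumrN -!big_split/= big1// => i _.
  rewrite /pseries_diffs /c/=; have i0 := ler0n R i.
  rewrite -[i.+1%:R]natr1; field.
  by rewrite !gt_eqF//; lra.
have := cvg_unique (@Rhausdorff R) H0 (@cvg_cst _ _ _ _ _).
rewrite /kummer /dkummer /ddkummer => E; rewrite -[RHS]E /psum; ring.
Unshelve. all: by end_near. Qed.

Lemma psum_le_head (d : R^nat) z : cvgn (pseries d z) -> 0 <= z ->
  (forall n, d n.+1 <= 0) -> psum d z <= d 0%N.
Proof.
move=> cd z0 d0; apply: limr_le => //; near=> m.
have m0 : (0 < m)%N by near: m.
rewrite /pseries/= /series/= -(prednK m0) big_nat_recl//= expr0 mulr1 gerDl.
by apply: sumr_le0 => i _; rewrite mulr_le0_ge0// exprn_ge0.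
Unshelve. all: by end_near. Qed.

Lemma psumD (c d : R^nat) z : cvgn (pseries c z) -> cvgn (pseries d z) ->
  cvgn (pseries (fun n => c n + d n) z) /\
  psum (fun n => c n + d n) z = psum c z + psum d z.
Proof.
move=> cc cd.
have E : pseries (fun n => c n + d n) z = pseries c z + pseries d z.
  rewrite /pseries -seriesD; congr series.
  by apply/funext => n /=; rewrite -[RHS]/(_ + _) mulrDl.
by rewrite /psum E; split; [exact: is_cvgD|rewrite limD].
Qed.

Lemma psumZ k (c : R^nat) z : cvgn (pseries c z) ->
  cvgn (pseries (fun n => k * c n) z) /\
  psum (fun n => k * c n) z = k * psum c z.
Proof.
move=> cc.
have E : pseries (fun n => k * c n) z = k *: pseries c z.
  rewrite /pseries -seriesZ; congr series.
  by apply/funext => n /=; rewrite -[RHS]/(_ * _) mulrA.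
by rewrite /psum E; split; [exact: is_cvgZl_tmp|rewrite limZl_tmp].
Qed.

Definition invfact : R^nat := fun n => n`!%:R^-1.

Lemma invfact_is_cvg z : cvgn (pseries invfact z).
Proof. by apply: fact_bounded_is_cvg => n; rewrite ger0_norm// invr_ge0. Qed.

Lemma psum_invfact z : psum invfact z = expR z.
Proof. by rewrite expRE. Qed.

Lemma invfactS_is_cvg z : cvgn (pseries (fun n => invfact n.+1) z).
Proof.
apply: fact_bounded_is_cvg => n; rewrite ger0_norm ?invr_ge0//.
by rewrite lef_pV2 ?posrE ?ltr0n ?fact_gt0// ler_nat leq_fact.
Qed.

Lemma mul_psum_invfactS z : z * psum (fun n => invfact n.+1) z = expR z - 1.
Proof.
pose b n : R := if n is m.+1 then (m.+1%:R)^-1 * invfact m.+1 else 0.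
have bb : fact_bounded b.
  move=> [|n]; first by rewrite normr0 invr_ge0.
  rewrite ger0_norm /= ?mulr_ge0 ?invr_ge0// -[leRHS]mul1r ler_wpM2r ?invr_ge0//.
  by rewrite invf_le1 ?ler1n ?ltr0n.
have db : pseries_diffs b = fun n => invfact n.+1.
  by apply/funext => n; rewrite /pseries_diffs /= mulrA divff// mul1r.
have e1 := @cvg_mul_psum_diffs _ z bb; rewrite db in e1.
have e2 : pseries invfact z - cst 1 @ \oo --> expR z - 1.
  by rewrite -psum_invfact; apply: cvgB; [exact: invfact_is_cvg|exact: cvg_cst].
apply: (cvg_unique (@Rhausdorff R) e1); apply: cvg_trans e2.
apply: near_eq_cvg; near=> n; have n0 : (0 < n)%N by near: n.
rewrite !fctE /pseries /series/= -(prednK n0) !big_nat_recl//=.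
rewrite {1}/invfact fact0 invr1 expr0 !mul0r add0r mul1r addrC addKr.
by apply: eq_bigr => i _; rewrite /b mulrA divff// mul1r.
Unshelve. all: by end_near. Qed.

Lemma kummer_coef1 a : kummer_coef a 1 = - (2 * a).
Proof. by rewrite /kummer_coef; field. Qed.

Lemma kummer_coefSS a n : kummer_coef a n.+2 =
  kummer_coef a n.+1 * ((n.+1%:R - a) / (n.+1%:R + 1 / 2)) / n.+2%:R.
Proof. by []. Qed.

Lemma invfactS n : invfact n.+1 = invfact n / n.+1%:R.
Proof. by rewrite /invfact factS natrM invfM mulrC. Qed.

Lemma invfact_gt0 n : 0 < invfact n.
Proof. by rewrite invr_gt0 ltr0n fact_gt0. Qed.

Lemma kummer_coefS_bounds a n : 0 <= a <= 1 / 2 ->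
  - (2 * a * invfact n.+1) <= kummer_coef a n.+1 <=
  - (2 * a * invfact n.+1 / (2 * n%:R + 1)).
Proof.
move=> /andP[a0 a1]; elim: n => [|n /andP[ih1 ih2]].
  by rewrite kummer_coef1 /invfact factS fact0 muln1 !(mulr0, add0r, invr1, mulr1) lexx.
rewrite kummer_coefSS (invfactS n.+1).
have n0 := ler0n R n; have i0 := invfact_gt0 n.+1.
have E : n.+1%:R = n%:R + 1 :> R by rewrite natr1.
have p2 : 0 < (n.+2%:R : R)^-1 by rewrite invr_gt0.
set q := (_ - a) / _.
have q1 : q <= 1 by rewrite /q ler_pdivrMr E; lra.
have q2 : (2 * n%:R + 1) / (2 * n.+1%:R + 1) <= q.
  rewrite /q ler_pdivlMr; last by lra.
  rewrite mulrAC ler_pdivrMr; last by rewrite E; lra.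
  by rewrite E; nra.
have q0 : 0 <= q by apply: le_trans q2; rewrite divr_ge0//; lra.
clearbody q; rewrite !mulrA -!mulNr; apply/andP; split.
  rewrite ler_wpM2r ?(ltW p2)//.
  have h := mulr_ge0 (mulr_ge0 a0 (ltW i0)) (_ : 0 <= 1 - q).
  have {}h := h ltac:(lra).
  have k : 0 <= (kummer_coef a n.+1 + 2 * a * invfact n.+1) * q by rewrite mulr_ge0//; lra.
  by lra.
rewrite [leRHS]mulrAC ler_wpM2r ?(ltW p2)//.
have h : kummer_coef a n.+1 * q <= - (2 * a * invfact n.+1 / (2 * n%:R + 1)) * q.
  by rewrite ler_wpM2r.
apply: (le_trans h); rewrite !mulNr lerN2.
have {}q2 : (2 * n.+1%:R + 1)^-1 <= (2 * n%:R + 1)^-1 * q.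
  by rewrite -ler_pdivrMl ?invr_gt0 ?invrK//; lra.
by rewrite -[leRHS]mulrA ler_wpM2l// !mulr_ge0// ltW.
Qed.

Lemma kummer_coefS_le0 a n : 0 <= a <= 1 / 2 -> kummer_coef a n.+1 <= 0.
Proof.
move=> a01; have /andP[_ /le_trans] := kummer_coefS_bounds n a01; apply.
have /andP[a0 _] := a01.
by rewrite oppr_le0 divr_ge0 ?mulr_ge0// ?(ltW (invfact_gt0 _))// addr_ge0// mulr_ge0.
Qed.

Lemma dkummer_lt0 a z : 0 < a <= 1 / 2 -> 0 <= z -> dkummer a z < 0.
Proof.
move=> /andP[a0 a1] z0; have a01 : 0 <= a <= 1 / 2 by lra.
apply: (@le_lt_trans _ _ (pseries_diffs (kummer_coef a) 0)).
  apply: psum_le_head => //.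
    exact/fact_bounded_is_cvg/fact_bounded_diffs/kummer_coef_bounded.
  by move=> n; rewrite /pseries_diffs mulr_ge0_le0// kummer_coefS_le0.
by rewrite /pseries_diffs kummer_coef1; lra.
Qed.

Lemma continuous_kummer a : 0 <= a <= 1 / 2 -> continuous (kummer a).
Proof.
move=> a01 z; apply/differentiable_continuous/derivable1_diffP.
by have [] := is_derive_kummer z a01.
Qed.

Lemma kummer_decreasing a x y : 0 < a <= 1 / 2 -> 0 <= x -> x < y ->
  kummer a y < kummer a x.
Proof.
move=> a01 x0 xy; have /andP[a0 a1] := a01.
have a01' : 0 <= a <= 1 / 2 by lra.
have [c cxy] := MVT xy (fun z _ => is_derive_kummer z a01')
  (continuous_subspaceT (continuous_kummer a01')).
move/eqP; rewrite subr_eq => /eqP ->.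
rewrite gtrDr nmulr_rlt0 ?subr_gt0// dkummer_lt0//.
by move: cxy; rewrite in_itv/= => /andP[/ltW /(le_trans x0)].
Qed.

Lemma kummer_ge a z : 0 <= a <= 1 / 2 -> 0 <= z ->
  1 + 2 * a - 2 * a * expR z <= kummer a z.
Proof.
move=> a01 z0.
have [c1 e1] := psumZ (2 * a) (@invfact_is_cvg z).
have [c2 e2] := psumD c1 (@kummer_is_cvg a z a01).
have [c3 e3] := psumZ (-1) c2.
have := psum_le_head c3 z0.
rewrite e3 e2 e1 psum_invfact -/(kummer a z) {2}/invfact fact0 invr1 => h.
suff : -1 * (2 * a * expR z + kummer a z) <= -1 * (2 * a * 1 + 1) by lra.
apply: h => n.
have /andP[h _] := kummer_coefS_bounds n a01; lra.
Qed.

Lemma kummer_le a z : 0 <= a <= 1 / 2 -> 0 <= z ->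
  a * (expR z - 1 - z) <= z * (1 - kummer a z).
Proof.
move=> a01 z0.
have [c1 e1] := psumZ a (@invfactS_is_cvg z).
have [c2 e2] := psumD c1 (@kummer_is_cvg a z a01).
have := psum_le_head c2 z0; rewrite e2 e1 -/(kummer a z) => h.
have {}h : a * psum (fun n => invfact n.+1) z + kummer a z <= a * invfact 1 + 1.
  apply: h => n; rewrite (invfactS n.+1).
  have /andP[_ h] := kummer_coefS_bounds n a01.
  have n0 := ler0n R n; have i0 := invfact_gt0 n.+1; have /andP[a0 a1] := a01.
  suff : a * (invfact n.+1 / n.+2%:R) <= 2 * a * invfact n.+1 / (2 * n%:R + 1).
    by move=> h2; apply: (le_trans (lerD h2 h)); rewrite subrr.
  rewrite [leRHS](_ : _ = a * (invfact n.+1 * (2 / (2 * n%:R + 1)))); last by field; lra.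
  rewrite !ler_wpM2l ?(ltW i0)// ler_pdivlMr; last by lra.
  rewrite mulrC ler_pdivrMr ?ltr0n// -[n.+2%:R]natr1 -[n.+1%:R]natr1; lra.
have := ler_wpM2l z0 h; rewrite mulrDr mulrCA mul_psum_invfactS.
rewrite /(invfact 1) factS fact0 muln1 invr1; lra.
Qed.

Lemma kummer_coef_lipschitz a b n : 0 <= a <= 1 / 2 -> 0 <= b <= 1 / 2 ->
  `|kummer_coef a n - kummer_coef b n| <= 2 * n%:R * `|a - b| * invfact n.
Proof.
move=> a01 b01; elim: n => [|n ih].
  by rewrite subrr normr0 mulr0 !mul0r.
rewrite invfactS /= -mulrBl normrM [X in _ * X <= _]gtr0_norm ?invr_gt0 ?ltr0n//.
rewrite [leRHS]mulrA ler_wpM2r ?invr_ge0//.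
set p := (n%:R - a) / _; set q := (n%:R - b) / _.
have := kummer_ratio_le1 n a01; rewrite -/p => p1.
have := kummer_coef_bounded b01 n; rewrite -/(invfact n) => b1.
have n0 := ler0n R n.
have pq : `|p - q| <= 2 * `|a - b|.
  rewrite -mulrBl opprB addrC addrA subrK normrM [X in _ * X]gtr0_norm; last by rewrite invr_gt0; lra.
  rewrite distrC mulrC ler_wpM2r//.
  by rewrite -[2]invrK lef_pV2 ?posrE; lra.
have -> : kummer_coef a n * p - kummer_coef b n * q =
  (kummer_coef a n - kummer_coef b n) * p + kummer_coef b n * (p - q) by ring.
apply: (le_trans (ler_normD _ _)); rewrite (normrM _ p) (normrM _ (p - q)).
have h1 := ler_pM (normr_ge0 _) (normr_ge0 _) ih p1.
have h2 := ler_pM (normr_ge0 _) (normr_ge0 _) b1 pq.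
by apply: (le_trans (lerD h1 h2)); rewrite -natr1; lra.
Qed.

Lemma kummer_lipschitz_le a b z : 0 <= a <= 1 / 2 -> 0 <= b <= 1 / 2 -> 0 <= z ->
  kummer a z - kummer b z <= 2 * z * expR z * `|a - b|.
Proof.
move=> a01 b01 z0.
have ib : fact_bounded invfact by move=> n; rewrite ger0_norm// invr_ge0.
have := @cvg_mul_psum_diffs _ z ib.
rewrite pseries_diffs_inv_fact psum_invfact => e0.
have e2 := @cvgMl_tmp _ _ _ eventually_filter _ (2 * `|a - b|) _ e0.
have c1 := cvgP _ e2.
have e1 := cvg_lim (@Rhausdorff R) e2.
have [c3 <-] := psumB (@kummer_is_cvg a z a01) (@kummer_is_cvg b z b01).
rewrite (_ : 2 * z * expR z * `|a - b| = 2 * `|a - b| * (z * expR z)); last by ring.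
rewrite -e1; apply: ler_lim => //.
near=> m; rewrite /pseries /series/= mulr_sumr; apply: ler_sum => i _.
rewrite !mulrA ler_wpM2r ?exprn_ge0//.
apply: (le_trans (ler_norm _)); apply: (le_trans (kummer_coef_lipschitz i a01 b01)).
by rewrite [2 * i%:R * _]mulrAC.
Unshelve. all: by end_near. Qed.

Lemma kummer_lipschitz a b z : 0 <= a <= 1 / 2 -> 0 <= b <= 1 / 2 -> 0 <= z ->
  `|kummer a z - kummer b z| <= 2 * z * expR z * `|a - b|.
Proof.
move=> a01 b01 z0; rewrite ler_norml lerNl opprB kummer_lipschitz_le// andbT.
by rewrite distrC kummer_lipschitz_le.
Qed.

Lemma kummer0 z : 0 <= z -> kummer 0 z = 1.
Proof.
move=> z0; have h : 0 <= (0 : R) <= 1 / 2 by apply/andP; split; [exact: lexx|lra].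
apply/eqP; rewrite eq_le; apply/andP; split.
  apply: (@psum_le_head (kummer_coef 0)) => // [|n]; first exact: kummer_is_cvg.
  exact: kummer_coefS_le0.
by have := kummer_ge h z0; lra.
Qed.

Lemma kummer_ivt a z : 0 <= a <= 1 / 2 -> 0 <= z -> kummer a z <= 0 ->
  exists2 b, 0 < b <= a & kummer b z = 0.
Proof.
move=> a01 z0 kaz; have /andP[a0 a1] := a01.
have cont : {within `[0, a], continuous (fun b => kummer b z)}.
  apply/subspace_continuousP => x /= xa; apply/cvgrPdist_le => /= e e0.
  pose C := 2 * z * expR z.
  have C0 : 0 <= C by rewrite !mulr_ge0// expR_ge0.
  near=> y; have ya : `[0, a]%classic y by near: y; exact: withinT.
  have xa' : 0 <= x <= 1 / 2 by move: xa; rewrite in_itv/= => /andP[]; lra.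
  have ya' : 0 <= y <= 1 / 2 by move: ya; rewrite /= in_itv/= => /andP[]; lra.
  apply: (le_trans (kummer_lipschitz xa' ya' z0)); rewrite -/C.
  apply: (@le_trans _ _ ((C + 1) * `|x - y|)); first by rewrite ler_wpM2r// lerDl.
  rewrite -ler_pdivlMl; last by lra.
  near: y; apply: cvg_within; apply/nbhs_ballP.
  exists ((C + 1)^-1 * e) => /=; first by rewrite mulr_gt0 ?invr_gt0//; lra.
  by move=> y /ltW.
have [|b] := @IVT _ _ 0 a 0 a0 cont.
  by rewrite (kummer0 z0) ge_min le_max kaz ler01 orbT.
rewrite in_itv/= => /andP[b0 ba] kb; exists b => //; rewrite ba andbT lt_def b0 andbT.
by apply/eqP => bE; move: kb; rewrite bE kummer0// => /eqP; rewrite oner_eq0.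
Unshelve. all: by end_near. Qed.

End kummer.

(** * The eigenvalue equation *)

Section real_derivatives.
Variable R : realType.
Implicit Types (f g F : R -> R) (x : R).

Lemma is_derive_mul f g x df dg : is_derive x 1 f df -> is_derive x 1 g dg ->
  is_derive x 1 (fun y => f y * g y) (df * g x + f x * dg).
Proof.
move=> hf hg; apply: (is_derive_eq (is_deriveM hf hg)).
by rewrite /GRing.scale/= addrC [g x * _]mulrC.
Qed.

Lemma is_derive_add f g x df dg : is_derive x 1 f df -> is_derive x 1 g dg ->
  is_derive x 1 (fun y => f y + g y) (df + dg).
Proof. by move=> hf hg; exact: is_deriveD. Qed.

Lemma is_derive_sub f g x df dg : is_derive x 1 f df -> is_derive x 1 g dg ->
  is_derive x 1 (fun y => f y - g y) (df - dg).
Proof. by move=> hf hg; exact: is_deriveB. Qed.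

Lemma is_derive_const (k : R) x : is_derive x 1 (fun=> k) 0.
Proof. exact: is_derive_cst. Qed.

Lemma is_derive_inv f x df : f x != 0 -> is_derive x 1 f df ->
  is_derive x 1 (fun y => (f y)^-1) (- (df / f x ^+ 2)).
Proof.
move=> f0 [hf <-]; split; first exact: derivableV.
by rewrite deriveV// /GRing.scale/= mulNr mulrC.
Qed.

Lemma is_derive_compose f g x df dg : is_derive x 1 f df ->
  is_derive (f x) 1 g dg -> is_derive x 1 (fun y => g (f y)) (dg * df).
Proof. by move=> hf hg; exact: is_derive1_comp. Qed.

Lemma is_derive_continuous f x df : is_derive x 1 f df -> {for x, continuous f}.
Proof. by move=> [hf _]; apply/differentiable_continuous/derivable1_diffP. Qed.

Lemma is_derive_ndecr (F dF : R -> R) (a b : R) :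
  (forall x, a < x < b -> is_derive x 1 F (dF x)) ->
  (forall x, a < x < b -> 0 <= dF x) ->
  forall x y, a < x -> x <= y -> y < b -> F x <= F y.
Proof.
move=> hF dF0 x y ax xy yb.
apply: (@ger0_derive1_le_oo _ F a b) => //.
- by move=> z; rewrite in_itv/= => /hF[].
- move=> z; rewrite in_itv/= => zab; have [_ e] := hF _ zab.
  by rewrite derive1E e dF0.
- by move=> z; rewrite inE/= in_itv/= => /hF /is_derive_continuous.
- by rewrite in_itv/= ax (le_lt_trans xy).
- by rewrite in_itv/= yb (lt_le_trans ax).
Qed.

End real_derivatives.

Section ornstein_uhlenbeck.
Variables (R : realType) (T : R).
Hypothesis T0 : 0 < T.
Implicit Types (l m x r : R) (f h : R -> R).

(* [f'' - (x / T) f' + l f = 0], where [df] plays the role of [f']. *)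
Definition ou_ode l f df x := is_derive x 1 f (df x) /\
  is_derive x 1 df (x / T * df x - l * f x).

Let p x := expR (- (x ^+ 2 / (2 * T))).

Let is_derive_p x : is_derive x 1 p (- (x / T) * p x).
Proof.
have hx := is_derive_id x (1 : R).
have h2 := is_derive_mul hx hx.
have h3 := is_derive_mul h2 (is_derive_const (2 * T)^-1 x).
have h4 := is_derive_sub (is_derive_const 0 x) h3.
have h5 := is_derive_compose h4 (is_derive_expR _).
have -> : p = (fun y => expR (0 - y * y * (2 * T)^-1)).
  by apply/funext => y; rewrite /p sub0r -expr2.
by apply: (is_derive_eq h5); rewrite /=; field; rewrite gt_eqF.
Qed.

(* With [q = f / h], the quantity [p h^2 q q' = p (f f' - f^2 h' / h)] is
   nondecreasing, so [q^2] is nondecreasing after [x0] or nonincreasing before. *)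
Lemma ou_ode_ratio_monotone l m r f df h dh :
  m <= l -> (forall x, - r < x < r -> ou_ode m f df x) ->
  (forall x, - r < x < r -> ou_ode l h dh x) ->
  (forall x, - r < x < r -> 0 < h x) ->
  forall x0, - r < x0 < r ->
    (forall x, x0 <= x < r -> (f x0 / h x0) ^+ 2 <= (f x / h x) ^+ 2) \/
    (forall x, - r < x <= x0 -> (f x0 / h x0) ^+ 2 <= (f x / h x) ^+ 2).
Proof.
move=> ml fE hE h0 x0 x0r.
pose V x := p x * (f x * df x - f x * f x * (dh x * (h x)^-1)).
have dV x : - r < x < r -> is_derive x 1 V
    (p x * ((df x - f x * dh x / h x) ^+ 2 + (l - m) * f x ^+ 2)).
  move=> xr; have [f1 f2] := fE x xr; have [h1 h2] := hE x xr.
  have hn0 : h x != 0 by rewrite gt_eqF// h0.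
  have A := is_derive_mul h2 (is_derive_inv hn0 h1).
  have B := is_derive_sub (is_derive_mul f1 f2) (is_derive_mul (is_derive_mul f1 f1) A).
  apply: (is_derive_eq (is_derive_mul (is_derive_p x) B)).
  by field; rewrite hn0 gt_eqF.
have dQ x : - r < x < r ->
    is_derive x 1 (fun y => (f y / h y) ^+ 2) (2 * V x / (p x * h x ^+ 2)).
  move=> xr; have [f1 f2] := fE x xr; have [h1 h2] := hE x xr.
  have hn0 : h x != 0 by rewrite gt_eqF// h0.
  have A := is_derive_mul f1 (is_derive_inv hn0 h1).
  have -> : (fun y => (f y / h y) ^+ 2) = (fun y => f y / h y * (f y / h y)).
    by apply/funext => y; rewrite expr2.
  apply: (is_derive_eq (is_derive_mul A A)); rewrite /V; field.
  by rewrite hn0 gt_eqF// expR_gt0.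
have p0 x : 0 < p x by exact: expR_gt0.
have Vmono := is_derive_ndecr dV.
have {}Vmono : forall x y, - r < x -> x <= y -> y < r -> V x <= V y.
  apply: Vmono => x xr; rewrite mulr_ge0 ?(ltW (p0 _))// addr_ge0 ?sqr_ge0//.
  by rewrite mulr_ge0 ?subr_ge0 ?sqr_ge0.
have /andP[x0l x0u] := x0r.
have dQ0 x : - r < x < r -> 0 <= V x -> 0 <= 2 * V x / (p x * h x ^+ 2).
  by move=> xr Vx; apply: divr_ge0; apply: mulr_ge0; rewrite ?sqr_ge0// ltW.
have [V0|/ltW V0] := lerP 0 (V x0); [left|right] => x /andP[xl xu].
  have [->//|xx0] := eqVneq x x0.
  have x0x : x0 < x by rewrite lt_neqAle eq_sym xx0.
  have sub z : z \in `]x0, x[ -> - r < z < r.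
    by rewrite in_itv/= => /andP[z1 z2]; rewrite (lt_trans x0l)// (lt_trans z2).
  have [|c cx] := MVT x0x (fun z zx => dQ z (sub z zx)).
    apply: continuous_in_subspaceT => z; rewrite inE/= in_itv/= => /andP[z1 z2].
    apply: is_derive_continuous; apply: dQ.
    by rewrite (lt_le_trans x0l)// (le_lt_trans z2).
  have cr := sub c cx.
  rewrite -subr_ge0 => ->; rewrite mulr_ge0 ?subr_ge0// dQ0//.
  move: cx; rewrite in_itv/= => /andP[c1 c2].
  by rewrite (le_trans V0)// Vmono// ?(ltW c1)// (lt_trans c2).
have [->//|xx0] := eqVneq x x0.
have x0x : x < x0 by rewrite lt_neqAle xx0.
have sub z : z \in `]x, x0[ -> - r < z < r.
  by rewrite in_itv/= => /andP[z1 z2]; rewrite (lt_trans xl)// (lt_trans z2).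
have [|c cx] := MVT x0x (fun z zx => dQ z (sub z zx)).
  apply: continuous_in_subspaceT => z; rewrite inE/= in_itv/= => /andP[z1 z2].
  apply: is_derive_continuous; apply: dQ.
  by rewrite (lt_le_trans xl)// (le_lt_trans z2).
have cr := sub c cx.
rewrite -subr_le0 => ->; rewrite mulr_le0_ge0 ?subr_ge0//.
rewrite mulr_le0_ge0//; last by rewrite invr_ge0 mulr_ge0 ?sqr_ge0// (ltW (p0 _)).
rewrite mulr_ge0_le0//; move: cx; rewrite in_itv/= => /andP[c1 c2].
by rewrite (le_trans _ V0)// Vmono// ?(ltW c2)// (lt_trans xl).
Qed.

Lemma ou_ode_root_unique l m r f df h dh :
  m < l -> 0 < r -> (forall x, ou_ode m f df x) -> (forall x, ou_ode l h dh x) ->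
  (forall x, 0 <= x < r -> 0 < f x) -> (forall x, 0 <= x < r -> 0 < h x) ->
  df 0 = 0 -> dh 0 = 0 -> f r = 0 -> h r = 0 -> False.
Proof.
move=> ml r0 fE hE f0 h0 df0 dh0 fr hr.
pose W x := p x * (df x * h x - f x * dh x).
have dW x : is_derive x 1 W ((l - m) * (p x * (f x * h x))).
  have [f1 f2] := fE x; have [h1 h2] := hE x.
  apply: (is_derive_eq (is_derive_mul (is_derive_p x)
    (is_derive_sub (is_derive_mul f2 h1) (is_derive_mul f1 h2)))).
  by field; rewrite gt_eqF.
have [c cr] := MVT r0 (fun z _ => dW z)
  (continuous_subspaceT (fun z => is_derive_continuous (dW z))).
rewrite {1 2}/W fr hr df0 dh0 !(mul0r, mulr0, subr0) => /esym/eqP; apply/negP.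
have {}cr : 0 <= c < r by move: cr; rewrite in_itv/= => /andP[/ltW-> ->].
by rewrite gt_eqF// !mulr_gt0 ?subr_gt0 ?expR_gt0 ?f0 ?h0.
Qed.

Definition ou_sol l x := kummer (l * T / 2) (x ^+ 2 / (2 * T)).
Definition dou_sol l x := dkummer (l * T / 2) (x ^+ 2 / (2 * T)) * (x / T).

Section solution.
Variable l : R.
Hypotheses (l0 : 0 < l) (lT : l * T <= 1).

Let a01 : 0 < l * T / 2 <= 1 / 2.
Proof. by apply/andP; split; [rewrite divr_gt0 ?mulr_gt0|rewrite ler_pM2r ?invr_gt0]. Qed.

Let a01' : 0 <= l * T / 2 <= 1 / 2.
Proof. by have /andP[/ltW -> ->] := a01. Qed.

Lemma ou_solP x : ou_ode l (ou_sol l) (dou_sol l) x.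
Proof.
have hx := is_derive_id x (1 : R).
have h2 := is_derive_mul (is_derive_mul hx hx) (is_derive_const (2 * T)^-1 x).
have E (F : R -> R) : (fun y => F (y ^+ 2 / (2 * T))) = (fun y => F (y * y * (2 * T)^-1)).
  by apply/funext => y; rewrite expr2.
have d1 := is_derive_compose h2 (is_derive_kummer _ a01').
have d2 := is_derive_mul (is_derive_compose h2 (is_derive_dkummer _ a01'))
  (is_derive_mul hx (is_derive_const T^-1 x)).
split.
  rewrite /ou_sol E; apply: (is_derive_eq d1).
  by rewrite /dou_sol expr2; field; rewrite gt_eqF.
rewrite /dou_sol (_ : (fun y => _) = (fun y => dkummer (l * T / 2) (y * y * (2 * T)^-1) * (y * T^-1))); last first.
  by apply/funext => y; rewrite expr2.
apply: (is_derive_eq d2).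
have := kummer_ode (x * x * (2 * T)^-1) a01'; rewrite /ou_sol expr2 /=.
set K := kummer _ _; set K1 := dkummer _ _; set K2 := ddkummer _ _ => ode.
apply/eqP; rewrite -subr_eq0; apply/eqP.
by have <- : 2 / T * 0 = 0 :> R; [exact: mulr0|rewrite -[X in _ = _ * X]ode; field; rewrite gt_eqF].
Qed.

Lemma dou_sol0 : dou_sol l 0 = 0.
Proof. by rewrite /dou_sol mul0r mulr0. Qed.

Lemma ou_sol_lt x y : `|x| < `|y| -> ou_sol l y < ou_sol l x.
Proof.
move=> xy; apply: kummer_decreasing => //; first by rewrite divr_ge0 ?sqr_ge0// mulr_ge0// ltW.
rewrite ltr_pM2r ?invr_gt0 ?mulr_gt0// -real_normK ?num_real// -[ltRHS]real_normK ?num_real//.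
by rewrite ltr_pXn2r ?nnegrE.
Qed.

Lemma ou_sol_norm x y : `|x| = `|y| -> ou_sol l x = ou_sol l y.
Proof.
by move=> xy; rewrite /ou_sol -real_normK ?num_real// xy real_normK ?num_real.
Qed.

End solution.

Lemma ou_sol_root_unique l m r : 0 < l -> l * T <= 1 -> 0 < m -> m * T <= 1 -> 0 < r ->
  ou_sol l r = 0 -> ou_sol m r = 0 -> l = m.
Proof.
move=> + + + + r0; wlog ml : l m / m < l.
  move=> H l0 lT m0 mT lr mr; have [h|h|//] := ltrgtP l m; last exact: (H l m).
  by symmetry; exact: (H m l).
move=> l0 lT m0 mT lr mr; exfalso.
apply: (ou_ode_root_unique ml r0 (ou_solP m0 mT) (ou_solP l0 lT) _ _
  (dou_sol0 m) (dou_sol0 l) mr lr) => x /andP[x0 xr].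
  by rewrite -mr; apply: ou_sol_lt => //; rewrite !ger0_norm// ltW.
by rewrite -lr; apply: ou_sol_lt => //; rewrite !ger0_norm// ltW.
Qed.

Lemma ou_sol_ivt l r : 0 < l -> l * T <= 1 -> ou_sol l r <= 0 ->
  exists2 m, 0 < m <= l & ou_sol m r = 0.
Proof.
move=> l0 lT lr.
have [||b /andP[b0 bl] br] := @kummer_ivt _ (l * T / 2) (r ^+ 2 / (2 * T)) _ _ lr.
- by apply/andP; split; [rewrite divr_ge0 ?mulr_ge0 ?ltW|rewrite ler_pM2r ?invr_gt0].
- by rewrite divr_ge0 ?sqr_ge0// mulr_ge0// ltW.
exists (2 * b / T); last by rewrite /ou_sol -[RHS]br; congr kummer; field; rewrite gt_eqF.
by rewrite divr_gt0 ?mulr_gt0//= ler_pdivrMr// mulrC -ler_pdivlMr//.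
Qed.



End ornstein_uhlenbeck.

(** * Gaussian measure and Dirichlet space *)

Section gaussian_measure.
Variables (R : realType) (T : R).
Hypothesis T0 : 0 < T.
Implicit Types (u f g phi : R -> R) (r a b c k e x y : R).
Local Notation gam := (gaussian T).
Local Notation leb := (@lebesgue_measure R).

Let s0 : Num.sqrt T != 0. Proof. by rewrite gt_eqF// sqrtr_gt0. Qed.

Lemma l2norm_lt_integral u e : (l2norm T u < e%:E)%E ->
  (\int[gam]_x ((u x) ^+ 2)%:E <= (e ^+ 2)%:E)%E.
Proof.
move=> ue.
have -> : (\int[gam]_x ((u x) ^+ 2)%:E = (l2norm T u) `^ 2)%E.
  rewrite /l2norm poweR_Lnorm//; apply: eq_integral => x _.
  by rewrite /= powR_mulrn// real_normK// num_real.
have n0 : (0 <= l2norm T u)%E by exact: Lnorm_ge0.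
have e0 : 0 <= e by rewrite -lee_fin (le_trans n0)// ltW.
rewrite -(@powR_mulrn _ e 2)// -poweR_EFin.
apply: gt0_ler_poweR => //; last exact: ltW.
  by rewrite in_itv/= n0 leey.
by rewrite in_itv/= lee_fin e0 leey.
Qed.

Lemma integral_l2norm_le u e : 0 <= e ->
  (\int[gam]_x ((u x) ^+ 2)%:E <= (e ^+ 2)%:E)%E -> (l2norm T u <= e%:E)%E.
Proof.
move=> e0 ue.
have -> : (l2norm T u = (\int[gam]_x ((u x) ^+ 2)%:E) `^ 2^-1)%E.
  rewrite /l2norm unlock /=; congr poweR; apply: eq_integral => x _.
  by rewrite /= powR_mulrn// real_normK// num_real.
have n0 : (0 <= \int[gam]_x ((u x) ^+ 2)%:E)%E.
  by apply: integral_ge0 => x _; rewrite lee_fin sqr_ge0.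
have -> : (e%:E = (e ^+ 2)%:E `^ 2^-1)%E.
  by rewrite poweR_EFin -powR_mulrn// -powRrM divff// powRr1.
apply: gt0_ler_poweR => //; first by rewrite in_itv/= n0 leey.
by rewrite in_itv/= lee_fin sqr_ge0 leey.
Qed.

Let pdf := normal_pdf 0 (Num.sqrt T).

Lemma gaussian_pdf_ge r x : `|x| <= r -> pdf r <= pdf x.
Proof.
move=> xr; rewrite /pdf !normal_pdfE// ler_wpM2l ?normal_peak_ge0//.
rewrite /normal_fun ler_expR !subr0 !mulNr lerN2 ler_wpM2r ?invr_ge0 ?mulrn_wge0 ?sqr_ge0//.
have r0 : 0 <= r by exact: le_trans xr.
by rewrite -real_normK ?num_real// ler_pXn2r ?nnegrE.
Qed.

Lemma gaussian_pdf_gt0 r : 0 < pdf r.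
Proof. by rewrite /pdf normal_pdfE// mulr_gt0 ?expR_gt0 ?normal_peak_gt0. Qed.

Lemma lebesgue_le_gaussian r (D A : set R) : measurable D -> measurable A ->
  D `<=` `[- r, r] -> A `<=` D -> ((pdf r)%:E * leb A <= gam A)%E.
Proof.
move=> mD mA Dr AD; rewrite /gaussian/= /normal_prob -/pdf.
rewrite -(integral_cst leb mA); apply: ge0_le_integral.
- exact: mA.
- by move=> x _; rewrite lee_fin ltW// gaussian_pdf_gt0.
- exact: measurable_cst.
- by apply: measurable_funTS; apply/measurable_EFinP; exact: measurable_normal_pdf.
- move=> x /AD/Dr /=; rewrite in_itv/= => xr.
  by rewrite lee_fin gaussian_pdf_ge// ler_norml.
Qed.

Lemma integral_lebesgue_le_gaussian r (D : set R) (u : R -> \bar R) :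
  measurable D -> D `<=` `[- r, r] -> measurable_fun setT u ->
  (forall x, 0 <= u x)%E ->
  ((pdf r)%:E * \int[leb]_(x in D) u x <= \int[gam]_(x in D) u x)%E.
Proof.
move=> mD Dr mu u0.
have k0 := ltW (gaussian_pdf_gt0 r).
pose k := NngNum k0.
pose m1 := mscale k (mrestr leb mD).
have -> : (\int[leb]_(x in D) u x = \int[mrestr leb mD]_(x in D) u x)%E.
  by apply: eq_measure_integral => A mA AD; rewrite -[RHS]/(leb (A `&` D)) setIidl.
rewrite -[X in (X%:E * _)%E]/(k%:num) -ge0_integral_mscale//; last first.
  exact: measurable_funTS.
apply: ge0_le_measure_integral => // S mS.
apply: (@le_trans _ _ (gam (S `&` D))); last first.
  by apply: le_measure; rewrite ?inE//; exact: measurableI.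
rewrite /mscale/=; apply: (lebesgue_le_gaussian mD) => //; exact: measurableI.
Qed.

Lemma sobolev_bound r a b k (F dF : R -> R) (I : \bar R) :
  - r <= a -> a < b -> b <= r -> 0 < k ->
  (forall x, is_derive x 1 F (dF x)) -> continuous dF ->
  (\int[gam]_x ((dF x) ^+ 2)%:E <= I)%E ->
  (`|F b - F a|%:E <= (k * (b - a))%:E + (k^-1 * (pdf r)^-1)%:E * I)%E.
Proof.
move=> ra ab br k0 hF cF hI.
have abr : `[a, b] `<=` `[- r, r].
  by move=> x /=; rewrite !in_itv/= => /andP[/(le_trans ra)-> /le_trans ->].
have mdF : measurable_fun setT dF := continuous_measurable_fun cF.
have msq : measurable_fun setT (fun x => ((dF x) ^+ 2)%:E).
  by apply/measurable_EFinP; exact: measurable_funX.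
have ftc : (\int[leb]_(x in `[a, b]) (dF x)%:E = (F b)%:E - (F a)%:E)%E.
  apply: continuous_FTC2 => //.
  - exact: continuous_subspaceT.
  - split=> [x _||]; first by have [] := hF x.
      by apply/cvg_at_right_filter; exact: is_derive_continuous (hF _).
    by apply/cvg_at_left_filter; exact: is_derive_continuous (hF _).
  - by move=> x _; rewrite derive1E; have [_ ->] := hF x.
have -> : (`|F b - F a|%:E = `| \int[leb]_(x in `[a, b]) (dF x)%:E |)%E by rewrite ftc.
apply: (le_trans (le_abse_integral _ _ _)) => //.
  by apply: measurable_funTS; apply/measurable_EFinP.
have -> : ((k * (b - a))%:E = \int[leb]_(x in `[a, b]) k%:E)%E.
  by rewrite integral_cst//= lebesgue_measure_itv/= lte_fin ab EFinM EFinB.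
have pr := gaussian_pdf_gt0 r.
have step : (\int[leb]_(x in `[a, b]) (k^-1%:E * ((dF x) ^+ 2)%:E) <=
             (k^-1 * (pdf r)^-1)%:E * I)%E.
  rewrite ge0_integralZl_EFin//=; first last.
  - by rewrite invr_ge0 ltW.
  - exact: measurable_funTS.
  - by move=> x _; rewrite lee_fin sqr_ge0.
  rewrite EFinM -muleA; apply: lee_wpmul2l; first by rewrite lee_fin invr_ge0 ltW.
  rewrite lee_pdivlMl//.
  apply: (le_trans (integral_lebesgue_le_gaussian _ abr _ _)) => //.
    by move=> x; rewrite lee_fin sqr_ge0.
  apply: le_trans hI; apply: ge0_subset_integral => //.
  by move=> x _; rewrite lee_fin sqr_ge0.
apply: (le_trans _ (leeD (lexx _) step)).
rewrite -ge0_integralD//=; first last.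
- by apply: measurable_funTS; apply: emeasurable_funM.
- by move=> x _; rewrite mule_ge0// lee_fin ?sqr_ge0// invr_ge0 ltW.
- by move=> x _; rewrite lee_fin ltW.
apply: ge0_le_integral => //.
- by apply: measurable_funTS; apply/measurable_EFinP; exact: measurableT_comp.
- by apply: measurable_funTS; apply: emeasurable_funD => //; apply: emeasurable_funM.
- move=> x _; rewrite -EFinM -EFinD lee_fin.
  rewrite -[_ ^+ 2]real_normK ?num_real//.
  have [h|/ltW h] := lerP `|dF x| k.
    by rewrite (le_trans h)// lerDl mulr_ge0 ?sqr_ge0// invr_ge0 ltW.
  rewrite (@le_trans _ _ (k^-1 * `|dF x| ^+ 2))//; last by rewrite lerDr ltW.
  by rewrite expr2 mulrA ler_peMl// -(@mulVf _ k) ?gt_eqF// ler_pM2l ?invr_gt0.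
Qed.

Lemma test_function_smooth r phi : test_function r phi ->
  (forall x, is_derive x 1 phi (derive1 phi x)) /\ continuous (derive1 phi).
Proof.
move=> [sm _ _]; split=> [x|x].
  by split; [exact: (sm 0%N x)|rewrite derive1E].
by apply/differentiable_continuous/derivable1_diffP; exact: (sm 1%N x).
Qed.

Lemma test_function_out r phi y : test_function r phi -> y \notin `]- r, r[ ->
  phi y = 0.
Proof.
move=> [_ _ K] yr; apply/eqP; apply: contraNT yr => phiy.
by apply: K; exact: subset_closure.
Qed.

Lemma test_function_near0 r phi y : test_function r phi -> y \notin `]- r, r[ ->
  exists2 d, 0 < d & forall x, `|y - x| < d -> phi x = 0.
Proof.
move=> [_ cK K] yr; set A := closure _ in cK K.
have : nbhs y (~` A).
  apply: open_nbhs_nbhs; split; first by apply: closed_openC; exact: closed_closure.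
  by move=> /K/=; exact/negP.
move=> /nbhs_ballP[d /= d0 H]; exists d => // x xd.
apply/eqP; apply: contraPT (H x xd) => phix; apply; exact: subset_closure.
Qed.

Let l2norm_sum_lt u v e : (l2norm T u + l2norm T v < e%:E)%E ->
  (l2norm T u < e%:E)%E /\ (l2norm T v < e%:E)%E.
Proof.
by move=> h; split; apply: le_lt_trans h; [apply: leeDl|apply: leeDr]; exact: Lnorm_ge0.
Qed.

Lemma integral_sqr_sub_le (g u v : R -> R) (I J : \bar R) :
  measurable_fun setT g -> measurable_fun setT u -> measurable_fun setT v ->
  (\int[gam]_x ((g x - u x) ^+ 2)%:E <= I)%E ->
  (\int[gam]_x ((g x - v x) ^+ 2)%:E <= J)%E ->
  (\int[gam]_x ((u x - v x) ^+ 2)%:E <= 2%:E * I + 2%:E * J)%E.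
Proof.
move=> mg mu mv hI hJ.
have m1 : measurable_fun setT (fun x => ((g x - u x) ^+ 2)%:E).
  by apply/measurable_EFinP; apply: measurable_funX; exact: measurable_funB.
have m2 : measurable_fun setT (fun x => ((g x - v x) ^+ 2)%:E).
  by apply/measurable_EFinP; apply: measurable_funX; exact: measurable_funB.
have two0 : (0 <= 2%:E :> \bar R)%E by rewrite lee_fin.
apply: le_trans (leeD (lee_wpmul2l two0 hI) (lee_wpmul2l two0 hJ)).
have sq0 (w : R -> R) : forall x : R, [set: R] x -> (0 <= ((w x) ^+ 2)%:E)%E.
  by move=> x _; rewrite lee_fin sqr_ge0.
rewrite -!ge0_integralZl_EFin//; [|exact: sq0|exact: sq0].
rewrite -ge0_integralD//; first last.
- exact: emeasurable_funM.
- by move=> x xT; rewrite mule_ge0// sq0.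
- exact: emeasurable_funM.
- by move=> x xT; rewrite mule_ge0// sq0.
apply: ge0_le_integral => //.
- exact: sq0.
- by apply/measurable_EFinP; apply: measurable_funX; exact: measurable_funB.
- by apply: emeasurable_funD; exact: emeasurable_funM.
move=> x _; rewrite -!EFinM -EFinD lee_fin -subr_ge0.
rewrite (_ : _ - _ = (2 * g x - u x - v x) ^+ 2); last by ring.
exact: sqr_ge0.
Qed.

(* Near [y = -r] or [y = r] the function [f] agrees with [f - phi1], which is
   approximated by functions vanishing at [y] with bounded Dirichlet energy. *)
Lemma dirichlet_space_vanish f r a b y c : 0 < c -> - r <= a -> a < b -> b <= r ->
  y = - r /\ y = a \/ y = r /\ y = b -> dirichlet_space T r f ->
  ~ (forall x, a < x < b -> c <= `|f x|).
Proof.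
move=> c0; wlog : a b / exists g phi1, [/\ measurable_fun setT f,
    measurable_fun setT g, test_function r phi1 /\
      (forall e, 0 < e -> exists2 phi, test_function r phi &
        (l2norm T (f \- phi)%R + l2norm T (g \- derive1 phi)%R < e%:E)%E),
    (\int[gam]_x ((g x - derive1 phi1 x) ^+ 2)%:E <= 1)%E &
    (forall x, a < x < b -> phi1 x = 0) /\ b - a <= c / 4 / (16 / (c * pdf r))].
  move=> H ra ab br yab fD fc.
  have [g [mf mg appr]] := fD.
  have [phi1 tphi1 /l2norm_sum_lt [_ /l2norm_lt_integral gphi1]] := appr 1 ltr01.
  have pr := gaussian_pdf_gt0 r.
  set K := c / 4 / (16 / (c * pdf r)).
  have K0 : 0 < K by rewrite !divr_gt0// mulr_gt0.
  have yr : y \notin `]- r, r[.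
    by case: yab => -[-> _]; rewrite in_itv/= ltxx ?andbF.
  have [d d0 hd] := test_function_near0 tphi1 yr.
  pose e := Num.min (b - a) (Num.min K (d / 2)).
  have e0 : 0 < e by rewrite !lt_min subr_gt0 ab K0 divr_gt0.
  have eba : e <= b - a by rewrite ge_min lexx.
  have eK : e <= K by rewrite !ge_min lexx orbT.
  have ed : e < d.
    by rewrite (@le_lt_trans _ _ (d / 2)) ?ge_min ?lexx ?orbT//; lra.
  rewrite expr1n in gphi1; clearbody e.
  case: yab => -[yr' yab].
    apply: (H a (a + e) _ ra _ _ (or_introl (conj yr' yab)) fD); [|lra|lra|].
    - exists g, phi1; split=> //; split=> [x /andP[ax xe]|]; last by rewrite addrAC subrr add0r.
      by apply: hd; rewrite yab ler0_norm; lra.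
    - by move=> x /andP[ax xe]; apply: fc; lra.
  apply: (H (b - e) b _ _ _ br (or_intror (conj yr' yab)) fD); [|lra|lra|].
  - exists g, phi1; split=> //; split=> [x /andP[ax xe]|]; last by rewrite subKr.
    by apply: hd; rewrite yab ger0_norm; lra.
  - by move=> x /andP[ax xe]; apply: fc; lra.
move=> [g [phi1 [mf mg [tphi1 appr] gphi1 [phi10 bak]]]] ra ab br yab _ fc.
have pr := gaussian_pdf_gt0 r.
pose k := 16 / (c * pdf r).
have k0 : 0 < k by rewrite divr_gt0// mulr_gt0.
pose v := (c / 2) ^+ 2 * (pdf r * (b - a)).
have v0 : 0 < v by rewrite !mulr_gt0 ?subr_gt0 ?exprn_gt0 ?divr_gt0.
pose e := Num.min 1 (v / 2).
have e0 : 0 < e by rewrite lt_min ltr01 divr_gt0.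
have e1 : e <= 1 by rewrite ge_min lexx.
have ev : e <= v / 2 by rewrite ge_min lexx orbT.
have [phi tphi /l2norm_sum_lt [/l2norm_lt_integral fphi /l2norm_lt_integral gphi]] := appr e e0.
have [dphi cphi] := test_function_smooth tphi.
have [dphi1 cphi1] := test_function_smooth tphi1.
pose F x := phi x - phi1 x; pose dF x := derive1 phi x - derive1 phi1 x.
have hF x : is_derive x 1 F (dF x) := is_derive_sub (dphi x) (dphi1 x).
have cF : continuous dF by move=> x; apply: cvgB; [exact: cphi|exact: cphi1].
have IF : (\int[gam]_x ((dF x) ^+ 2)%:E <= 4%:E)%E.
  apply: (le_trans (integral_sqr_sub_le mg _ _ gphi gphi1)).
  - exact: continuous_measurable_fun.
  - exact: continuous_measurable_fun.
  - rewrite -!EFinM -EFinD lee_fin.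
    have : e ^+ 2 <= 1 by rewrite expr_le1// ltW.
    lra.
have yr : y \notin `]- r, r[.
  by case: yab => -[-> _]; rewrite in_itv/= ltxx ?andbF.
have Fy : F y = 0.
  by rewrite /F (test_function_out tphi yr) (test_function_out tphi1 yr) subrr.
have Fx x : a < x < b -> `|phi x| <= c / 2.
  move=> xab; have /andP[ax xb] := xab.
  have -> : phi x = F x by rewrite /F phi10// subr0.
  have kE : k^-1 / pdf r * 4 = c / 4.
    by rewrite /k; field; rewrite !gt_eqF.
  have kb : k * (b - a) <= c / 4 by rewrite mulrC -ler_pdivlMr.
  case: yab => -[_ yE].
    have := sobolev_bound ra ax (ltW (lt_le_trans xb br)) k0 hF cF IF.
    rewrite -yE Fy subr0 -EFinM -EFinD lee_fin kE => /le_trans; apply.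
    have : k * (x - y) <= k * (b - a) by rewrite ler_pM2l// yE; lra.
    lra.
  have := sobolev_bound (ltW (le_lt_trans ra ax)) xb br k0 hF cF IF.
  rewrite -yE Fy sub0r normrN -EFinM -EFinD lee_fin kE => /le_trans; apply.
  have : k * (y - x) <= k * (b - a) by rewrite ler_pM2l// yE; lra.
  lra.
have abr : `]a, b[ `<=` `[- r, r].
  by move=> x /=; rewrite !in_itv/= => /andP[h1 h2]; apply/andP; split; lra.
have lower : (v%:E <= \int[gam]_(x in `]a, b[) ((f x - phi x) ^+ 2)%:E)%E.
  apply: (@le_trans _ _ (\int[gam]_(x in `]a, b[) ((c / 2) ^+ 2)%:E)%E).
    rewrite integral_cst//= /v EFinM lee_pmul2l ?fin_numE// ?lte_fin ?exprn_gt0 ?divr_gt0//.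
    apply: le_trans (@lebesgue_le_gaussian r `]a, b[ `]a, b[ _ _ abr _) => //.
    by rewrite lebesgue_measure_itv/= lte_fin ab EFinM EFinB.
  apply: ge0_le_integral => //.
  - by move=> x _; rewrite lee_fin sqr_ge0.
  - apply: measurable_funTS; apply/measurable_EFinP; apply: measurable_funX.
    apply: measurable_funB => //; apply: continuous_measurable_fun.
    by move=> x; exact: is_derive_continuous (dphi x).
  - move=> x /=; rewrite in_itv/= => xab; rewrite lee_fin.
    rewrite -[leRHS]real_normK ?num_real// ler_pXn2r ?nnegrE//; last by rewrite divr_ge0 ?ltW.
    have := lerB_dist (f x) (phi x); have := fc x xab; have := Fx x xab; lra.
have h : v <= e ^+ 2.
  rewrite -lee_fin; apply: (le_trans lower); apply: le_trans fphi.
  apply: ge0_subset_integral => //.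
  - apply/measurable_EFinP; apply: measurable_funX.
    apply: measurable_funB => //; apply: continuous_measurable_fun.
    by move=> x; exact: is_derive_continuous (dphi x).
  - by move=> x _; rewrite lee_fin sqr_ge0.
have : e ^+ 2 <= e by rewrite expr2 ger_pMr.
lra.
Qed.

Lemma dirichlet_space_zero f r : dirichlet_space T r f ->
  (forall x, x \in `]- r, r[ -> f x = 0) -> {ae gam, forall x, f x = 0}.
Proof.
move=> [g [mf mg appr]] f0.
have I0 : (\int[gam]_x ((f x) ^+ 2)%:E)%E = 0%E.
  apply/eqP; rewrite eq_le; apply/andP; split; last first.
    by apply: integral_ge0 => x _; rewrite lee_fin sqr_ge0.
  apply/lee_addgt0Pr => e e0; rewrite add0e.
  have s0' : 0 < Num.sqrt e by rewrite sqrtr_gt0.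
  have [phi tphi /l2norm_sum_lt [/l2norm_lt_integral fphi _]] := appr _ s0'.
  rewrite sqr_sqrtr ?(ltW e0)// in fphi.
  have [dphi _] := test_function_smooth tphi.
  have mphi : measurable_fun setT phi.
    apply: continuous_measurable_fun.
    by move=> x; exact: is_derive_continuous (dphi x).
  apply: le_trans fphi; apply: ge0_le_integral => //.
  - by move=> x _; rewrite lee_fin sqr_ge0.
  - by apply/measurable_EFinP; exact: measurable_funX.
  - by apply/measurable_EFinP; apply: measurable_funX; exact: measurable_funB.
  - move=> x _; rewrite lee_fin /=; have [xr|xr] := boolP (x \in `]- r, r[).
      by rewrite f0// expr0n sqr_ge0.
    by rewrite (test_function_out tphi xr) subr0.
have N0 : l2norm T f = 0%E.
  apply/eqP; rewrite eq_le; apply/andP; split; last exact: Lnorm_ge0.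
  by apply: integral_l2norm_le => //; rewrite I0 expr0n.
have /(_ _ _) H := @Lnorm_eq0_eq0 _ _ _ gam (EFin \o f) 2%:E _ _ N0.
have {}H : (EFin \o f) = \0%E %[ae gam].
  by apply: H; [exact/measurable_EFinP|rewrite lte_fin].
by apply: (@filterS _ _ (ae_filter_ringOfSetsType gam) _ _ _ H) => x /= /(_ I) [].
Qed.

End gaussian_measure.

(** * Lower bound for the eigenvalues *)

Section leading_eigenvalue_lower_bound.
Variables (R : realType) (T : R).
Hypothesis T0 : 0 < T.
Implicit Types (l m r x : R).

Lemma ou_sol_ge l r x : 0 < l -> l * T <= 1 -> `|x| <= `|r| ->
  ou_sol T l r <= ou_sol T l x.
Proof.
move=> l0 lT; rewrite le_eqVlt => /orP[/eqP xr|xr].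
  by rewrite (ou_sol_norm T l xr).
by rewrite ltW// ou_sol_lt.
Qed.

Lemma dirichlet_eigenvalue_gt l m r : 0 < r -> 0 < l -> l * T <= 1 ->
  0 < ou_sol T l r -> dirichlet_eigenvalue T r m -> l < m.
Proof.
move=> r0 l0 lT hr [m0 [f [fD fn0 df fE]]]; rewrite ltNge; apply/negP => ml.
have [f0|] := pselect (forall x, x \in `]- r, r[ -> f x = 0).
  exact/fn0/(dirichlet_space_zero fD f0).
move=> /existsNP[x0 /not_implyP[x0r /eqP fx0]].
have x0r' : - r < x0 < r by move: x0r; rewrite in_itv.
have fode x : - r < x < r -> ou_ode T m f (derive1 f) x.
  move=> xr; have xr' : x \in `]- r, r[ by rewrite in_itv.
  have [d1 d2] := df x xr'; split; first by split; rewrite ?derive1E.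
  split=> //; rewrite -derive1E; have := fE x xr'.
  by rewrite /ou_generator /= => /eqP; rewrite eqr_oppLR => /eqP e; lra.
have hge x : - r < x < r -> ou_sol T l r <= ou_sol T l x.
  move=> /andP[x1 x2]; apply: ou_sol_ge => //.
  by rewrite (ger0_norm (ltW r0)) ler_norml !ltW.
have h0 x : - r < x < r -> 0 < ou_sol T l x by move=> /hge; exact: lt_le_trans.
pose c := `|f x0 / ou_sol T l x0| * ou_sol T l r.
have c0 : 0 < c by rewrite mulr_gt0// normr_gt0 mulf_neq0// invr_eq0 gt_eqF ?h0.
have fc x : - r < x < r ->
    (f x0 / ou_sol T l x0) ^+ 2 <= (f x / ou_sol T l x) ^+ 2 -> c <= `|f x|.
  move=> xr; rewrite -[leLHS]real_normK ?num_real// -[leRHS]real_normK ?num_real//.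
  rewrite ler_pXn2r ?nnegrE// => h; rewrite /c.
  have hx := h0 x xr.
  rewrite (@le_trans _ _ (`|f x / ou_sol T l x| * ou_sol T l x))//.
    by rewrite ler_pM ?(ltW hr)// hge.
  by rewrite normrM normfV (gtr0_norm hx) divfK// gt_eqF.
have /andP[x0l x0u] := x0r'.
have [H|H] := ou_ode_ratio_monotone T0 ml fode (fun x _ => ou_solP T0 l0 lT x) h0 x0r'.
  apply: (dirichlet_space_vanish T0 c0 (ltW x0l) x0u (lexx r) (or_intror (conj _ _)) fD) => // x /andP[x1 x2].
  by apply: fc; [rewrite x2 (lt_trans x0l)|apply: H; rewrite x2 ltW].
apply: (dirichlet_space_vanish T0 c0 (lexx _) x0l (ltW x0u) (or_introl (conj _ _)) fD) => // x /andP[x1 x2].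
by apply: fc; [rewrite x1 (lt_trans x2)|apply: H; rewrite x1 ltW].
Qed.

End leading_eigenvalue_lower_bound.

(** * Smooth functions *)

Section smooth_functions.
Variable R : realType.
Implicit Types (f g : R -> R) (n k : nat) (x t : R).

Fixpoint cdiff n f : Prop :=
  (forall x, derivable f x 1) /\ (if n is m.+1 then cdiff m (derive1 f) else True).

Lemma cdiff_derivable n f x : cdiff n f -> derivable f x 1.
Proof. by case: n => [|n] []. Qed.

Lemma cdiffW n f : cdiff n.+1 f -> cdiff n f.
Proof.
elim: n f => [|n ih] f [df cf]; first by split.
by split; [exact: df|exact: ih].
Qed.

Lemma smoothP f : smooth f <-> forall n, cdiff n f.
Proof.
split=> [sf n|cf n].
  elim: n f sf => [f sf|n ih f sf]; first by split=> //; exact: (sf 0%N).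
  split; first exact: (sf 0%N).
  by apply: ih => m x; rewrite -derive1Sn; exact: sf.
elim: n f cf => [f cf x|n ih f cf x]; first exact: cdiff_derivable (cf 0%N).
by rewrite derive1Sn; apply: ih => m; have [] := cf m.+1.
Qed.

Lemma derive1_eq f df : (forall x, is_derive x 1 f (df x)) -> derive1 f = df.
Proof. by move=> h; apply/funext => x; rewrite derive1E; have [_ ->] := h x. Qed.

Lemma derivable_is_derive f x : derivable f x 1 -> is_derive x 1 f (derive1 f x).
Proof. by move=> h; split => //; rewrite derive1E. Qed.

Lemma cdiff_cst n (c : R) : cdiff n (fun=> c).
Proof.
elim: n c => [|n ih] c; first by split=> [x|//]; exact: derivable_cst.
split=> [x|]; first exact: derivable_cst.
by rewrite (derive1_eq (is_derive_const c)).
Qed.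

Lemma cdiff_id n : cdiff n (fun x => x).
Proof.
case: n => [|n]; first by split=> [x|//]; exact: derivable_id.
split=> [x|]; first exact: derivable_id.
rewrite (derive1_eq (fun x => is_derive_id x (1 : R))); exact: cdiff_cst.
Qed.

Lemma cdiffD n f g : cdiff n f -> cdiff n g -> cdiff n (fun x => f x + g x).
Proof.
elim: n f g => [|n ih] f g [df hf] [dg hg].
  by split=> [x|//]; exact: derivableD.
split=> [x|]; first exact: derivableD.
have D x := is_derive_add (derivable_is_derive (df x)) (derivable_is_derive (dg x)).
by rewrite (derive1_eq D); exact: ih.
Qed.

Lemma cdiffM n f g : cdiff n f -> cdiff n g -> cdiff n (fun x => f x * g x).
Proof.
elim: n f g => [|n ih] f g cf cg.
  by split=> [x|//]; apply: derivableM; [exact: cdiff_derivable cf|exact: cdiff_derivable cg].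
have [df hf] := cf; have [dg hg] := cg.
split=> [x|]; first exact: derivableM.
have D x := is_derive_mul (derivable_is_derive (df x)) (derivable_is_derive (dg x)).
by rewrite (derive1_eq D); apply: cdiffD; apply: ih => //; exact: cdiffW.
Qed.

Lemma cdiff_comp n f g : cdiff n g -> cdiff n f -> cdiff n (fun x => g (f x)).
Proof.
have D (h u : R -> R) x : (forall y, derivable h y 1) -> (forall y, derivable u y 1) ->
    is_derive x 1 (fun y => h (u y)) (derive1 h (u x) * derive1 u x).
  by move=> dh du; apply: is_derive_compose; apply: derivable_is_derive.
elim: n f g => [|n ih] f g cg cf; have [dg hg] := cg; have [df hf] := cf.
  by split=> [x|//]; have [] := D g f x dg df.
split=> [x|]; first by have [] := D g f x dg df.
rewrite (derive1_eq (fun x => D g f x dg df)).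
by apply: cdiffM => //; apply: ih => //; exact: cdiffW.
Qed.

Lemma cdiff_psum n (c : R^nat) : fact_bounded c -> cdiff n (psum c).
Proof.
elim: n c => [|n ih] c cb.
  by split=> [x|//]; have [] := psum_is_derive x cb.
split=> [x|]; first by have [] := psum_is_derive x cb.
by rewrite (derive1_eq (fun x => psum_is_derive x cb)); apply/ih/fact_bounded_diffs.
Qed.

(* The powers of [1 / t] make the family closed under differentiation. *)
Definition flat k t : R := if 0 < t then t^-1 ^+ k * expR (- t^-1) else 0.

Lemma flat_le k t : 0 <= flat k t <= k.+2`!%:R * t ^+ 2.
Proof.
rewrite /flat; case: ifPn => [t0|_]; last by rewrite lexx mulr_ge0 ?sqr_ge0.
rewrite mulr_ge0 ?expR_ge0 ?exprn_ge0 ?invr_ge0 ?(ltW t0)//=.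
have := expR_ge1Dxn k.+1 (_ : 0 <= t^-1); rewrite invr_ge0 (ltW t0) => /(_ isT) h.
have f0 : 0 < k.+2`!%:R :> R by rewrite ltr0n fact_gt0.
have {}h : t^-1 ^+ k.+2 <= k.+2`!%:R * expR t^-1.
  by rewrite mulrC -ler_pdivrMr//; lra.
rewrite expRN ler_pdivrMr ?expR_gt0// mulrAC -ler_pdivrMr ?exprn_gt0//.
by apply: le_trans h; rewrite -exprVn -exprD addn2.
Qed.

Lemma is_derive_flat k t :
  is_derive t 1 (flat k) (flat k.+2 t - k%:R * flat k.+1 t).
Proof.
have [t0|t0|->] := ltrgtP t 0.
- rewrite {2 3}/flat ltNge (ltW t0)/= mulr0 subr0.
  apply: (near_eq_is_derive _ (is_derive_const 0 t)).
  near=> y; rewrite /flat ltNge; have -> // : y <= 0.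
  by apply: ltW; near: y; exact: lt_nbhsl.
- rewrite {2 3}/flat t0.
  have tn0 : t != 0 by rewrite gt_eqF.
  have i1 := is_derive_inv tn0 (is_derive_id t (1 : R)).
  have e1 := is_derive_compose (is_derive_sub (is_derive_const 0 t) i1) (is_derive_expR _).
  have p1 : is_derive t 1 (fun y => y^-1 ^+ k) (- (k%:R * t^-1 ^+ k.+1)).
    elim: k => [|j ih].
      rewrite mul0r oppr0; under eq_fun do rewrite expr0; exact: is_derive_const.
    under eq_fun do rewrite exprS.
    apply: (is_derive_eq (is_derive_mul i1 ih)).
    by rewrite -natr1 !exprS; field.
  have m1 := is_derive_mul p1 e1.
  have near_t : \near t, t^-1 ^+ k * expR (0 - t^-1) = flat k t.
    near=> y; rewrite /flat sub0r; have -> // : 0 < y.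
    by near: y; exact: lt_nbhsr.
  apply: (is_derive_eq (near_eq_is_derive near_t m1)).
  by rewrite sub0r !exprS; field.
- have flat0 j : flat j 0 = 0 by rewrite /flat ltxx.
  rewrite !flat0 mulr0 subr0.
  have : (fun h : R => h^-1 *: ((flat k \o shift 0) (h *: 1) - flat k 0)) @ 0^' --> (0 : R).
    apply/cvgrPdist_le => e e0; near=> h.
    have h0 : h != 0 by near: h; exact: nbhs_dnbhs_neq.
    rewrite sub0r normrN /= flat0 subr0 addr0 [h *: 1]mulr1 /GRing.scale/= normrM normfV.
    have /andP[l0 l1] := flat_le k h.
    rewrite ger0_norm// mulrC ler_pdivrMr ?normr_gt0//.
    apply: (le_trans l1); rewrite -real_normK ?num_real// expr2 mulrA ler_wpM2r//.
    rewrite -ler_pdivlMl ?ltr0n ?fact_gt0//.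
    apply: ltW; near: h; apply: dnbhs0_lt.
    by rewrite mulr_gt0// invr_gt0 ltr0n fact_gt0.
  move=> c0; split; first by apply/cvg_ex; exists 0.
  exact: cvg_lim c0.
Unshelve. all: by end_near. Qed.

Lemma cdiff_flat n k : cdiff n (flat k).
Proof.
elim: n k => [|n ih] k.
  by split=> [x|//]; have [] := is_derive_flat k x.
split=> [x|]; first by have [] := is_derive_flat k x.
rewrite (derive1_eq (is_derive_flat k)).
rewrite (_ : (fun _ => _) = (fun t => flat k.+2 t + (- k%:R) * flat k.+1 t)).
  by apply: cdiffD => //; apply: cdiffM => //; exact: cdiff_cst.
by apply/funext => t; rewrite mulNr.
Qed.

End smooth_functions.

(** * The positive part of a smooth function *)

Section positive_part.
Variables (R : realType) (T r : R).
Hypothesis r0 : 0 < r.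
Local Notation gam := (gaussian T).
Implicit Types d x : R.

Lemma mul_flatS k (u : R) : u * flat k.+1 u = flat k u.
Proof.
rewrite /flat; case: ifPn => [u0|_]; last by rewrite mulr0.
by rewrite exprS !mulrA divff ?gt_eqF// mul1r.
Qed.

Lemma flat_eq0 k (u : R) : u <= 0 -> flat k u = 0.
Proof. by rewrite /flat ltNge => ->. Qed.

Lemma flat01_bounds (u : R) : 0 < u -> 1 - u^-1 <= flat 0 u <= 1 /\
  flat 0 u <= flat 0 u + flat 1 u <= 1.
Proof.
move=> u0; rewrite /flat u0 expr0 expr1 mul1r.
have s0 : 0 < u^-1 by rewrite invr_gt0.
have h1 : 1 - u^-1 <= expR (- u^-1) by rewrite expR_ge1Dx.
have h2 : expR (- u^-1) <= 1 by rewrite -expR0 ler_expR oppr_le0 ltW.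
have h3 : (1 + u^-1) * expR (- u^-1) <= 1.
  rewrite expRN ler_pdivrMr ?expR_gt0// mul1r; exact: expR_ge1Dx.
have h4 : 0 <= u^-1 * expR (- u^-1) by rewrite mulr_ge0 ?expR_ge0// ltW.
by split; apply/andP; split => //; lra.
Qed.

Variables (h dh : R -> R).
Hypotheses (smooth_h : smooth h) (hD : forall x : R, is_derive x 1 h (dh x)).
Hypotheses (h_out : forall x, x \notin `]- r, r[ -> h x <= 0).
Hypotheses (h_in : forall x, x \in `]- r, r[ -> 0 < h x).

Let pos x := Num.max (h x) 0.
Let dpos x := dh x * \1_(`]- r, r[) x.

(* For [h <= d] this is [0], and for [h > d] it is [v exp(- d / v)] with
   [v = h - d], which is uniformly close to [h]. *)
Let cut (d : R) x := (h x - d) * flat 0 ((h x - d) / d).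
Let dcut (d : R) x := dh x * (flat 0 ((h x - d) / d) + flat 1 ((h x - d) / d)).

Let is_derive_cut d x : 0 < d -> is_derive x 1 (cut d) (dcut d x).
Proof.
move=> d0; have e1 := is_derive_sub (hD x) (is_derive_const d x).
have e2 := is_derive_mul e1 (is_derive_const d^-1 x).
apply: (is_derive_eq (is_derive_mul e1 (is_derive_compose e2 (is_derive_flat 0 _)))).
by rewrite /dcut -(mul_flatS 1 _); field; rewrite gt_eqF.
Qed.

Let continuous_h : continuous h.
Proof. by move=> x; exact: is_derive_continuous (hD x). Qed.

Let cut_test d : 0 < d -> test_function r (cut d).
Proof.
move=> d0.
have sub : closure [set x | cut d x != 0] `<=` [set x | d <= h x].
  have cl : closed [set x | d <= h x].
    by apply: (@closed_comp _ _ h [set y | d <= y]) => [x _|]; [exact: continuous_h|exact: closed_ge].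
  rewrite [X in _ `<=` X]((closure_id _).1 cl); apply: closure_subset => x /=.
  rewrite leNgt; apply: contraNN => hd.
  by rewrite /cut flat_eq0 ?mulr0// pmulr_lle0 ?invr_gt0// subr_le0 ltW.
have sub2 : [set x | d <= h x] `<=` `]- r, r[.
  move=> x /= dx; apply: contraPT dx => /h_out hx0; apply/negP; rewrite -ltNge.
  exact: le_lt_trans d0.
split.
- apply/smoothP => n; have hn := (smoothP _).1 smooth_h n.
  have vn : cdiff n (fun x => h x - d) by exact: (cdiffD hn (cdiff_cst n (- d))).
  have un := cdiffM vn (cdiff_cst n d^-1).
  exact: (cdiffM vn (cdiff_comp (cdiff_flat R n 0) un)).
- apply: (subclosed_compact _ (@segment_compact _ (- r) r)); first exact: closed_closure.
  by move=> x /sub /sub2 /=; rewrite !in_itv/= => /andP[/ltW-> /ltW->].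
- by move=> x /sub /sub2.
Qed.

Let cut_close d x : 0 < d -> `|pos x - cut d x| <= 2 * d.
Proof.
move=> d0; rewrite /pos /cut; have [hd|hd] := lerP (h x) d.
  rewrite flat_eq0 ?mulr0 ?subr0; last by rewrite pmulr_lle0 ?invr_gt0// subr_le0.
  by rewrite ger0_norm ?le_max ?lexx ?orbT// ge_max; apply/andP; split; lra.
rewrite max_l; last by rewrite ltW// (lt_trans d0).
set v := h x - d; have v0 : 0 < v by rewrite subr_gt0.
have u0 : 0 < v / d by rewrite divr_gt0.
have [/andP[f1 f2] _] := flat01_bounds u0.
have g1 : v * (1 - (v / d)^-1) <= v * flat 0 (v / d) by rewrite ler_pM2l.
have g2 : v * flat 0 (v / d) <= v * 1 by rewrite ler_pM2l.
have e : v * (1 - (v / d)^-1) = v - d by field; rewrite !gt_eqF.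
have hE : h x = v + d by rewrite /v subrK.
rewrite hE ger0_norm; lra.
Qed.

Lemma positive_part_dirichlet : continuous dh ->
  dirichlet_space T r (fun x => Num.max (h x) 0).
Proof.
move=> cdh.
have mh : measurable_fun setT h := continuous_measurable_fun continuous_h.
have mdh : measurable_fun setT dh := continuous_measurable_fun cdh.
have mpos : measurable_fun setT pos by apply: measurable_maxr => //; exact: measurable_cst.
have mdpos : measurable_fun setT dpos.
  by apply: measurable_funM => //; exact: measurable_indic.
exists dpos; split=> // e e0.
have [M M0 hM] : exists2 M, 0 <= M & forall x, x \in `]- r, r[ -> (dh x) ^+ 2 <= M.
  have [||c cr hc] := @EVT_max R (fun x => (dh x) ^+ 2) (- r) r.
  - by rewrite (@le_trans _ _ 0) ?oppr_le0// ltW.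
  - apply: continuous_subspaceT => x; apply: continuousM; exact: cdh.
  - exists ((dh c) ^+ 2); first exact: sqr_ge0.
    by move=> x; rewrite in_itv/= => /andP[/ltW x1 /ltW x2]; apply: hc; rewrite in_itv/= x1.
pose d (n : nat) : R := n.+1%:R^-1.
have d0 n : 0 < d n by rewrite invr_gt0 ltr0n.
have mdcut n : measurable_fun setT (dcut (d n)).
  have [_ c] := test_function_smooth (cut_test (d0 n)).
  rewrite -(derive1_eq (fun x => is_derive_cut x (d0 n))).
  exact: continuous_measurable_fun.
pose F n x := ((dpos x - dcut (d n) x) ^+ 2)%:E.
have mF n : measurable_fun setT (F n).
  by apply/measurable_EFinP; apply: measurable_funX; exact: measurable_funB.
have Fout n x : x \notin `]- r, r[ -> dpos x - dcut (d n) x = 0.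
  move=> xr; have u0 : (h x - d n) / d n <= 0.
    by rewrite pmulr_lle0 ?invr_gt0// subr_le0 (le_trans (h_out xr))// ltW.
  rewrite /dpos /dcut !flat_eq0// addr0 mulr0 subr0 indicE.
  by rewrite memNset ?mulr0//=; exact/negP.
have Fin n x : x \in `]- r, r[ -> dpos x - dcut (d n) x =
    dh x * (1 - (flat 0 ((h x - d n) / d n) + flat 1 ((h x - d n) / d n))).
  move=> xr; rewrite /dpos /dcut indicE mem_set//= mulr1; ring.
have G01 (u : R) : 0 <= flat 0 u + flat 1 u <= 1.
  have [u0|u0] := lerP u 0.
    by rewrite !flat_eq0// addr0 lexx ler01.
  have [_ h2] := flat01_bounds u0.
  have /andP[h3 _] := flat_le 0 u; lra.
have Fbound n x : 0 <= (dpos x - dcut (d n) x) ^+ 2 <= M.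
  rewrite sqr_ge0/=; have [xr|xr] := boolP (x \in `]- r, r[); last first.
    by rewrite Fout// expr0n.
  rewrite Fin// exprMn -[leRHS]mulr1 ler_pM ?sqr_ge0 ?hM//.
  by have := G01 ((h x - d n) / d n); set G := _ + _ => g; rewrite expr_le1//; lra.
have Fcvg x : (fun n => (dpos x - dcut (d n) x) ^+ 2) @ \oo --> (0 : R).
  have [xr|xr] := boolP (x \in `]- r, r[); last first.
    rewrite (_ : (fun _ => _) = fun=> 0); first exact: cvg_cst.
    by apply/funext => n; rewrite Fout// expr0n.
  have hx := h_in xr.
  apply/cvgrPdist_le => eps eps0; near=> n.
  rewrite sub0r normrN ger0_norm ?sqr_ge0// Fin// exprMn.
  set u := (h x - d n) / d n.
  have uE : u = h x * n.+1%:R - 1 by rewrite /u /d; field.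
  have un : (M + 1) / eps <= u.
    rewrite uE lerBrDr -ler_pdivrMl//.
    rewrite (@le_trans _ _ n%:R)// ?ler_nat//.
    by near: n; exact: nbhs_infty_ger.
  have u0 : 0 < u by apply: lt_le_trans un; rewrite divr_gt0//; lra.
  have [/andP[g1 _] /andP[g2 _]] := flat01_bounds u0.
  have := G01 u; set G := _ + _ => /andP[G0 G1].
  have Gu : 1 - G <= u^-1 by rewrite /G; lra.
  apply: (@le_trans _ _ (M * u^-1)).
    rewrite ler_pM ?sqr_ge0 ?hM//; apply: le_trans Gu.
    by rewrite expr2 ler_piMr; lra.
  rewrite ler_pdivrMr// mulrC -ler_pdivrMr//; apply: le_trans un.
  by rewrite ler_pM2r ?invr_gt0//; lra.
have [] := @dominated_convergence _ _ _ gam setT measurableT F (cst 0%E) (cst M%:E) mF.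
- exact: measurable_cst.
- apply: aeW => x _ /=; apply: cvg_EFin; last exact: Fcvg.
  by apply: nearW => n; rewrite fin_numE.
- exact: finite_measure_integrable_cst.
- apply: aeW => x n _ /=; have /andP[h1 h2] := Fbound n x.
  by rewrite ger0_norm// lee_fin.
move=> _ _; rewrite integral0 => /fine_cvgP[IFfin /cvgrPdist_lt IF].
pose q := e / 4; have q0 : 0 < q by rewrite divr_gt0.
have [n [nq nfin nd]] : exists n, [/\ fine (\int[gam]_x F n x)%E < q ^+ 2,
    (\int[gam]_x F n x)%E \is a fin_num & 2 * d n <= q].
  near \oo => n; exists n; split.
  - have : `|0 - fine (\int[gam]_x F n x)%E| < q ^+ 2.
      by near: n; apply: IF; rewrite exprn_gt0.
    by rewrite sub0r normrN; apply: le_lt_trans; exact: ler_norm.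
  - by near: n.
  - rewrite ler_pdivrMr ?ltr0n// -ler_pdivrMl//.
    rewrite (@le_trans _ _ n%:R)// ?ler_nat//.
    by near: n; exact: nbhs_infty_ger.
exists (cut (d n)); first exact: cut_test.
have l1 : (l2norm T (pos \- cut (d n))%R <= q%:E)%E.
  apply: integral_l2norm_le; first exact: ltW.
  apply: (@le_trans _ _ (\int[gam]_x (cst (q ^+ 2)%:E x))%E).
    apply: ge0_le_integral => //.
    - by move=> x _; rewrite lee_fin sqr_ge0.
    - apply/measurable_EFinP; apply: measurable_funX; apply: measurable_funB => //.
      have [D _] := test_function_smooth (cut_test (d0 n)).
      by apply: continuous_measurable_fun => x; exact: is_derive_continuous (D x).
    - move=> x _; rewrite lee_fin -[leLHS]real_normK ?num_real//.
      by rewrite ler_pXn2r ?nnegrE// ?(ltW q0)// (le_trans _ nd)// cut_close.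
  by rewrite integral_cst//= probability_setT mule1.
have l2 : (l2norm T (dpos \- derive1 (cut (d n)))%R <= q%:E)%E.
  rewrite (derive1_eq (fun x => is_derive_cut x (d0 n))).
  apply: integral_l2norm_le; first exact: ltW.
  by rewrite -(fineK nfin) lee_fin ltW.
by apply: (le_lt_trans (leeD l1 l2)); rewrite -EFinD lte_fin /q; lra.
Unshelve. all: by end_near. Qed.

End positive_part.

(** * The leading eigenvalue *)

Section leading_eigenvalue_characterization.
Variables (R : realType) (T : R).
Hypothesis T0 : 0 < T.
Implicit Types (l m r x : R).

Lemma smooth_ou_sol l : 0 <= l * T / 2 <= 1 / 2 -> smooth (ou_sol T l).
Proof.
move=> a01; apply/smoothP => n.
have c1 := cdiffM (cdiffM (cdiff_id R n) (cdiff_id R n)) (cdiff_cst n (2 * T)^-1).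
have c2 := cdiff_comp (cdiff_psum n (kummer_coef_bounded a01)) c1.
exact: c2.
Qed.

Lemma gaussian_itv_gt0 r : 0 < r -> (0 < gaussian T `](- r)%R, r[%classic)%E.
Proof.
move=> r0; have rr : - r < r by rewrite (@lt_trans _ _ 0) ?oppr_lt0.
have h := @lebesgue_le_gaussian R T T0 r `]- r, r[%classic `]- r, r[%classic _ _ _ (@subset_refl _ _).
apply: lt_le_trans (h _ _ _) => //; last exact: subset_itv_oo_cc.
rewrite lebesgue_measure_itv/= lte_fin rr -EFinB -EFinM lte_fin.
by rewrite mulr_gt0 ?gaussian_pdf_gt0 ?subr_gt0.
Qed.

Lemma ou_sol_eigenvalue l r : 0 < r -> 0 < l -> l * T <= 1 ->
  ou_sol T l r = 0 -> dirichlet_eigenvalue T r l.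
Proof.
move=> r0 l0 lT hr; have ode := ou_solP T0 l0 lT.
have a01 : 0 <= l * T / 2 <= 1 / 2.
  by apply/andP; split; [rewrite divr_ge0 ?mulr_ge0 ?ltW|rewrite ler_pM2r ?invr_gt0].
set h := ou_sol T l in hr ode *; set dh := dou_sol T l in ode.
have h_out x : x \notin `]- r, r[ -> h x <= 0.
  move=> xr; rewrite -hr; apply: ou_sol_ge => //; rewrite (ger0_norm (ltW r0)).
  by rewrite leNgt ltr_norml; move: xr; rewrite in_itv.
have h_in x : x \in `]- r, r[ -> 0 < h x.
  rewrite in_itv/= => xr; rewrite -hr; apply: ou_sol_lt => //.
  by rewrite (ger0_norm (ltW r0)) ltr_norml.
pose f x := Num.max (h x) 0.
have fh x : x \in `]- r, r[ -> \near x, h x = f x.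
  move=> xr; near=> y; rewrite /f max_l// ltW// h_in//.
  by near: y; exact: near_in_itvoo.
have df x : x \in `]- r, r[ -> is_derive x 1 f (dh x).
  by move=> xr; apply: (near_eq_is_derive (fh x xr)); have [] := ode x.
have d1f x : x \in `]- r, r[ -> derive1 f x = dh x.
  by move=> xr; rewrite derive1E; have [_ ->] := df x xr.
have d1fh x : x \in `]- r, r[ -> \near x, dh x = derive1 f x.
  by move=> xr; near=> y; rewrite d1f//; near: y; exact: near_in_itvoo.
have ddf x : x \in `]- r, r[ -> is_derive x 1 (derive1 f) (x / T * dh x - l * h x).
  by move=> xr; apply: (near_eq_is_derive (d1fh x xr)); have [] := ode x.
split; first exact: ltW.
exists f; split.
- have hD x : is_derive x 1 h (dh x) by case: (ode x).
  have cdh : continuous dh.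
    by move=> x; have [_ dx] := ode x; exact: is_derive_continuous dx.
  exact: (positive_part_dirichlet T r0 (smooth_ou_sol a01) hD h_out h_in cdh).
- move=> /negligibleS H.
  have : (gaussian T).-negligible `]- r, r[.
    apply: H => x /= xr; apply/eqP.
    by rewrite /f max_l ?gt_eqF ?h_in// ltW// h_in.
  move=> /measure_negligible N; have /eqP := N (measurable_itv _).
  by rewrite gt_eqF// gaussian_itv_gt0.
- by move=> x xr; split; [have [] := df x xr|have [] := ddf x xr].
- move=> x xr; rewrite /ou_generator /= derive1E.
  have [_ ->] := ddf x xr; rewrite d1f// /f max_l ?ltW ?h_in//; ring.
Unshelve. all: by end_near. Qed.

Lemma leading_eigenvalue_root l r : 0 < r -> 0 < l -> l * T <= 1 ->
  ou_sol T l r = 0 -> leading_eigenvalue T r = l.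
Proof.
move=> r0 l0 lT hr.
have El := ou_sol_eigenvalue r0 l0 lT hr.
have lb : lbound (dirichlet_eigenvalue T r) l.
  move=> m Em; rewrite leNgt; apply/negP => ml.
  have m0 : 0 <= m by case: Em.
  pose k := (m + l) / 2.
  have mk : m < k by rewrite /k; lra.
  have kl : k < l by rewrite /k; lra.
  have k0 : 0 < k by lra.
  have kT : k * T <= 1 by rewrite (le_trans _ lT)// ler_pM2r// ltW.
  have [hk|hk] := ltP 0 (ou_sol T k r).
    have := dirichlet_eigenvalue_gt T0 r0 k0 kT hk Em; lra.
  have [j /andP[j0 jk] hj] := ou_sol_ivt T0 k0 kT hk.
  have jT : j * T <= 1 by rewrite (le_trans _ kT)// ler_pM2r.
  have := ou_sol_root_unique T0 j0 jT l0 lT r0 hj hr; lra.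
apply: xget_unique => // m [Em mlb].
by apply/eqP; rewrite eq_le (mlb l El) (lb m Em).
Qed.

Lemma leading_eigenvalue_eq l r : 0 < r -> 0 < l -> l * T <= 1 ->
  leading_eigenvalue T r = l -> ou_sol T l r = 0.
Proof.
move=> r0 l0 lT le.
have El : dirichlet_eigenvalue T r l.
  move: le; rewrite /leading_eigenvalue; case: xgetP => [_ -> [El _] <- //|_ l00].
  by rewrite -l00 ltxx in l0.
have [h|h|//] := ltrgtP (ou_sol T l r) 0; last first.
  by have := dirichlet_eigenvalue_gt T0 r0 l0 lT h El; rewrite ltxx.
have [m /andP[m0 ml] hm] := ou_sol_ivt T0 l0 lT (ltW h).
have mT : m * T <= 1 by rewrite (le_trans _ lT)// ler_pM2r.
by have := leading_eigenvalue_root r0 m0 mT hm; rewrite le => ->.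
Qed.

Lemma ou_sol_root_exists l : 0 < l -> l * T <= 1 ->
  exists2 r, 0 < r & ou_sol T l r = 0.
Proof.
move=> l0 lT; pose a := l * T / 2.
have a0 : 0 < a by rewrite divr_gt0 ?mulr_gt0.
have a1 : a <= 1 / 2 by rewrite ler_pM2r ?invr_gt0.
have a01 : 0 <= a <= 1 / 2 by rewrite ltW.
pose z := 6 * (1 + a^-1).
have ia : 0 < a^-1 by rewrite invr_gt0.
have z0 : 0 <= z by rewrite /z; lra.
have Kz : kummer a z <= 0.
  have h := kummer_le a01 z0; have := expR_ge1Dxn 2 z0.
  rewrite (_ : 3`!%:R = 6 :> R)// => h2.
  have h3 : a * (z ^+ 3 / 6 - z) <= a * (expR z - 1 - z) by rewrite ler_pM2l//; lra.
  have h4 : z <= a * (z ^+ 3 / 6 - z).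
    have -> : a * (z ^+ 3 / 6 - z) = z * (a * (6 * (1 + a^-1) ^+ 2 - 1)).
      by rewrite /z; field; rewrite gt_eqF.
    rewrite ler_peMr// -ler_pdivrMl// mulr1.
    have : 0 <= a^-1 ^+ 2 by rewrite sqr_ge0.
    rewrite sqrrD; lra.
  have : z * (1 - kummer a z) >= z * 1 by lra.
  by rewrite ler_pM2l; [lra|rewrite /z; lra].
have [|c] := @IVT _ (kummer a) 0 z 0 z0 (continuous_subspaceT (continuous_kummer a01)).
  by rewrite kummer_at0 ge_min le_max Kz ler01 orbT.
rewrite in_itv/= => /andP[c0 _] kc.
have c0' : 0 < c.
  rewrite lt_def c0 andbT; apply/eqP => cE.
  by move: kc; rewrite cE kummer_at0 => /eqP; rewrite oner_eq0.
exists (Num.sqrt (2 * T * c)); first by rewrite sqrtr_gt0 !mulr_gt0.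
rewrite /ou_sol sqr_sqrtr; last by rewrite ltW// !mulr_gt0.
by rewrite -[RHS]kc; congr kummer; field; rewrite gt_eqF.
Qed.

Lemma leading_eigenvalue_invP l : 0 < l -> l * T <= 1 ->
  0 < leading_eigenvalue_inv T l /\ ou_sol T l (leading_eigenvalue_inv T l) = 0.
Proof.
move=> l0 lT; have [r r0 hr] := ou_sol_root_exists l0 lT.
have S : set_surj `]0, +oo[ [set l] (leading_eigenvalue T).
  move=> _ ->; exists r; first by rewrite /= in_itv/= r0.
  exact: leading_eigenvalue_root.
have inv0 : 0 < leading_eigenvalue_inv T l.
  have := @surjpinv_image_sub _ _ (fun=> 0) _ _ _ S (leading_eigenvalue_inv T l).
  rewrite /= in_itv/= andbT; apply; by exists l.
split=> //; apply: leading_eigenvalue_eq => //.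
by apply: (surjpK (fun=> 0) S); rewrite inE.
Qed.

End leading_eigenvalue_characterization.

(** * Asymptotics *)

Section asymptotics.
Variable R : realType.
Implicit Types (T z : R).

Let D : R := ln (2 + 4 * pi) + 1.

Lemma kummer_root_bounds T z : 0 < T -> T < expR (- 1) -> 0 <= z ->
  kummer (1 / (2 * pi) * T / 2) z = 0 ->
  1 <= Num.sqrt z / Num.sqrt (ln (1 / T)) <=
    Num.sqrt (ln (1 / T))^-1 + Num.sqrt (1 + D * (ln (1 / T))^-1).
Proof.
move=> T0 Te z0 Kz.
have pi2 : 2 <= pi :> R by exact: pi_ge2.
pose a : R := 1 / (2 * pi) * T / 2.
have aE : a = T / (4 * pi) by rewrite /a; field; lra.
have e1 : expR (- 1) <= 1 :> R by rewrite -[leRHS]expR0 ler_expR lerN10.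
have T1 : T < 1 by exact: lt_le_trans e1.
have a0 : 0 < a by rewrite aE divr_gt0//; lra.
have a01 : 0 <= a <= 1 / 2.
  by rewrite ltW//= aE ler_pdivrMr; lra.
set L := ln (1 / T).
have eL : expR L = T^-1 by rewrite /L div1r lnK// posrE invr_gt0.
have L1 : 1 < L by rewrite -ltr_expR eL -[ltLHS]invrK -expRN ltf_pV2// posrE ?expR_gt0.
have lower : L <= z.
  rewrite -ler_expR eL; have := kummer_ge a01 z0; rewrite Kz => h.
  have h2 : 1 <= 2 * a * expR z by have := a0; lra.
  rewrite -div1r ler_pdivrMr//; apply: (le_trans h2).
  rewrite mulrC ler_pM2l ?expR_gt0// aE.
  have : T / (4 * pi) <= T / 8 by rewrite ler_pM2l// lef_pV2 ?posrE; lra.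
  lra.
have z1 : 1 <= z by lra.
have upper : expR z <= (2 + 4 * pi) * z * expR L.
  have := kummer_le a01 z0; rewrite Kz subr0 mulr1 => h.
  have {}h : expR z - 1 - z <= 4 * pi * z * expR L.
    rewrite eL (_ : _ / T = z / a); last by rewrite aE; field; lra.
    by rewrite ler_pdivlMr// mulrC.
  have h2 : 1 + z <= 2 * z * expR L.
    have : 1 <= expR L by rewrite -[leLHS]expR0 ler_expR; lra.
    nra.
  lra.
set s := Num.sqrt z; set q := Num.sqrt L.
have s0 : 0 < s by rewrite sqrtr_gt0; lra.
have q0 : 0 < q by rewrite sqrtr_gt0; lra.
have sz : s ^+ 2 = z by rewrite sqr_sqrtr.
have qL : q ^+ 2 = L by rewrite sqr_sqrtr; lra.
have pi4 : 0 < 2 + 4 * pi :> R by lra.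
have upper2 : z <= ln (2 + 4 * pi) + 2 * s + L.
  have zp : 0 < z by lra.
  have : z <= ln ((2 + 4 * pi) * z * expR L).
    rewrite -[leLHS]expRK ler_ln// posrE ?expR_gt0// !mulr_gt0 ?expR_gt0//.
  rewrite !lnM ?posrE ?mulr_gt0 ?expR_gt0// expRK => /le_trans; apply.
  have lz : ln z = ln s *+ 2 by rewrite -lnXn// sz.
  have := ln_sublinear s0; rewrite lz mulr2n; lra.
have D0 : 0 <= D by rewrite /D addr_ge0// ln_ge0; lra.
have upper3 : s <= 1 + Num.sqrt (L + D).
  have h : (s - 1) ^+ 2 <= L + D by rewrite /D sqrrB1; lra.
  by rewrite -lerBlDl (le_trans (ler_norm _))// -sqrtr_sqr ler_wsqrtr.
apply/andP; split; first by rewrite ler_pdivlMr// mul1r ler_wsqrtr.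
rewrite sqrtrV -/q; last by lra.
have -> : 1 + D / L = (L + D) / L by field; lra.
rewrite sqrtrM; last by lra.
rewrite sqrtrV -/q; last by lra.
by rewrite -[X in _ <= X + _]mul1r -mulrDl ler_pM2r ?invr_gt0.
Qed.

Lemma cvg_inv_lnV : (ln (1 / T))^-1 @[T --> 0^'+] --> (0 : R).
Proof.
apply/cvgrPdist_le => e e0; near=> T.
have T0 : 0 < T by near: T; exact: nbhs_right_gt.
have Te : T < expR (- e^-1) by near: T; apply: nbhs_right_lt; exact: expR_gt0.
have eL : e^-1 < ln (1 / T).
  by rewrite div1r lnV ?posrE// ltrNr -[ltRHS]expRK ltr_ln// posrE expR_gt0.
have L0 : 0 < ln (1 / T) by apply: lt_trans eL; rewrite invr_gt0.
rewrite sub0r normrN ger0_norm ?invr_ge0 ?(ltW L0)//.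
by rewrite -[leRHS]invrK lef_pV2 ?posrE ?invr_gt0// ltW.
Unshelve. all: by end_near. Qed.

Lemma cvg_upper_bound :
  (fun T => Num.sqrt (ln (1 / T))^-1 + Num.sqrt (1 + D * (ln (1 / T))^-1))
    @ 0^'+ --> (1 : R).
Proof.
have E : Num.sqrt 0 + Num.sqrt (1 + D * 0) = 1 :> R.
  by rewrite mulr0 addr0 sqrtr0 sqrtr1 add0r.
rewrite -[X in _ --> X]E; apply: cvgD.
  by apply: continuous_cvg cvg_inv_lnV; exact: sqrt_continuous.
apply: continuous_cvg; first exact: sqrt_continuous.
apply: cvgD; first exact: cvg_cst.
by apply: cvgMl_tmp; exact: cvg_inv_lnV.
Qed.

End asymptotics.

Theorem proposition6p4 (R : realType) :
  (fun T : R => leading_eigenvalue_inv T (1 / (2 * pi))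
                / Num.sqrt (2 * T * ln (1 / T)))
    @ 0^'+ --> (1 : R).
Proof.
apply: (@squeeze_cvgr _ _ _ _ (fun=> 1)); last exact: cvg_upper_bound; last first.
  exact: cvg_cst.
near=> T.
have T0 : 0 < T by near: T; exact: nbhs_right_gt.
have Te : T < expR (- 1) by near: T; apply: nbhs_right_lt; exact: expR_gt0.
have pi2 : 2 <= pi :> R by exact: pi_ge2.
pose l : R := 1 / (2 * pi).
have l0 : 0 < l by rewrite divr_gt0//; lra.
have T1 : T <= 1.
  by rewrite ltW// (lt_le_trans Te)// -[leRHS]expR0 ler_expR lerN10.
have lT : l * T <= 1.
  rewrite mulr_ile1 ?(ltW l0) ?(ltW T0)// /l ler_pdivrMr; lra.
have [r0 hr] := leading_eigenvalue_invP T0 l0 lT.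
set r := leading_eigenvalue_inv T l in r0 hr *.
pose z := r ^+ 2 / (2 * T).
have z0 : 0 <= z by rewrite divr_ge0 ?sqr_ge0// mulr_ge0// ltW.
have := kummer_root_bounds T0 Te z0 hr.
rewrite (_ : r / _ = Num.sqrt z / Num.sqrt (ln (1 / T)))//.
have T2 : 0 < 2 * T by rewrite mulr_gt0.
have rE : r = Num.sqrt (2 * T) * Num.sqrt z.
  rewrite -(sqrtrM _ (ltW T2)) /z mulrCA divff ?gt_eqF// mulr1 sqrtr_sqr.
  by rewrite gtr0_norm.
rewrite {1}rE (sqrtrM _ (ltW T2)) invfM mulrACA divff ?mul1r//.
by rewrite gt_eqF// sqrtr_gt0.
Unshelve. all: by end_near. Qed.
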